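(* (1) For every non-degenerate source of shared randomness $\rho$, every $n\in\mathbb{N}$ and every communication problem (possibly partial function) $f$ on $\{0,1\}^n\times\{0,1\}^n$, $$\mathit{SMP}_\rho(f)=\widetilde{O}\bigl(\mathit{SMP}_{\mathit{perf}}(f)\cdot \mathrm{col}_\rho(n)\bigr).$$ (2) Moreover, there exists a family of partial functions $\{g_n\}$, indexed by $n\ge 2$ a power of two, namely $g_n=\mathit{GAPIP}_n$, such that for every non-degenerate source of shared randomness $\rho$, $$\mathit{SMP}_\rho(g_n)=\widetilde{\Theta}\bigl(\mathrm{col}_\rho(n)\bigr).$$ Here $\widetilde O$ and $\widetilde\Theta$ suppress factors polylogarithmic in $n$: $X=\widetilde O(Y)$ means $X\le C(1+\log n)^k\,Y$ for absolute constants $C,k$, and $X=\widetilde\Theta(Y)$ means $X=\widetilde O(Y)$ and $Y=\widetilde O(X)$.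
   Context: All logarithms are base 2. Sources. A source of shared randomness (bipartite distribution) is a probability distribution $\rho$ on $U\times V$ with $U,V$ finite. It is degenerate if its marginal on $U$ or its marginal on $V$ is a point mass, and non-degenerate otherwise. $\rho_{\mathit{perf}}$ is the uniform distribution on $\{(0,0),(1,1)\}\subset\{0,1\}\times\{0,1\}$. SMP model with source $\rho$. A protocol for a partial function $f$ fixes $\ell\in\mathbb{N}$ and uses independent samples $(u_1,v_1),\dots,(u_\ell,v_\ell)\sim\rho$. Alice receives her input $x$ and $(u_1,\dots,u_\ell)$; Bob receives his input $y$ and $(v_1,\dots,v_\ell)$. Each sends a single message, depending only on what they received, to a referee, who sees only the two messages and outputs an answer. Players and referee may also use private independent randomness. The protocol has error probability $\delta$ if for every input $(x,y)$ in the domain of $f$ the answer is $f(x,y)$ with probability at least $1-\delta$. The cost is the maximum possible total number of bits sent by Alice and Bob. $\mathit{SMP}_\rho(f)$ is the minimum cost of a protocol with source $\rho$ solving $f$ with error probability less than $1/3$; $\mathit{SMP}_{\mathit{perf}}=\mathit{SMP}_{\rho_{\mathit{perf}}}$. Collision complexity. A $p$-collision protocol for $\rho$ with domain size $n$ consists of $\ell\in\mathbb{N}$ and maps $A\colon U^\ell\to\mathcal P([n])$, $B\colon V^\ell\to\mathcal P([n])$ (possibly randomised using private independent randomness) such that $\Pr_{(\vec u,\vec v)\sim\rho^{\otimes\ell}}[i\in A(\vec u)\cap B(\vec v)]\ge p$ for every $i\in[n]$. Its complexity (output size) is the maximum possible value of $\max\{|A(\vec u)|,|B(\vec v)|\}$.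 $\mathrm{col}_\rho(n,p)$ is the infimum of the complexity over all $p$-collision protocols for $\rho$ with domain size $n$, and $\mathrm{col}_\rho(n)=\mathrm{col}_\rho(n,1/n)$. Gap inner product. For $x=(x_1,\dots,x_n),y=(y_1,\dots,y_n)$ with $x_i,y_i\in\mathbb{F}_2^m$, and $x_i\cdot y_i$ the inner product over $\mathbb{F}_2$, $\mathit{GAPIP}_{n,m}(x,y)=0$ if $|\{i\in[n]:x_i\cdot y_i=0\}|\ge 2n/3$, it equals $1$ if $|\{i\in[n]:x_i\cdot y_i=1\}|\ge 2n/3$, and is undefined ($\bot$, outside the promise) otherwise. For $n\ge2$ a power of two, $\mathit{GAPIP}_n=\mathit{GAPIP}_{n,8\log n}$. *)

(* Defs.v *)
From HB Require Import structures.
From mathcomp Require Import all_boot all_order all_algebra.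
From mathcomp Require Import all_classical all_reals all_analysis.

Set Implicit Arguments.
Unset Strict Implicit.
Unset Printing Implicit Defensive.

Import Order.TTheory GRing.Theory Num.Theory.
Local Open Scope ring_scope.

Record dist (R : realType) (T : finType) := Dist {
  mass :> T -> R;
  mass_ge0 : forall t, 0 <= mass t;
  mass_sum1 : \sum_t mass t = 1 }.

Definition Pr (R : realType) (T : finType) (d : dist R T) (E : pred T) : R :=
  \sum_(t | E t) d t.

Section Products.
Variable R : realType.

Lemma prod_ge0 (S T : finType) (d : dist R S) (e : dist R T) (w : S * T) :
  0 <= d w.1 * e w.2.
Proof. by rewrite mulr_ge0 ?mass_ge0. Qed.

Lemma prod_sum1 (S T : finType) (d : dist R S) (e : dist R T) :
  \sum_(w : S * T) d w.1 * e w.2 = 1.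
Proof.
rewrite -(pair_bigA _ (fun s t => d s * e t)) /=.
under eq_bigr => s _ do rewrite -mulr_sumr mass_sum1 mulr1.
exact: mass_sum1.
Qed.

Definition prod_dist (S T : finType) (d : dist R S) (e : dist R T) :
  dist R (S * T)%type := Dist (prod_ge0 d e) (prod_sum1 d e).

Lemma iid_ge0 (T : finType) (d : dist R T) (l : nat) (w : {ffun 'I_l -> T}) :
  0 <= \prod_i d (w i).
Proof. by apply: prodr_ge0 => i _; apply: mass_ge0. Qed.

Lemma iid_sum1 (T : finType) (d : dist R T) (l : nat) :
  \sum_(w : {ffun 'I_l -> T}) \prod_i d (w i) = 1.
Proof.
rewrite -(bigA_distr_bigA (fun (_ : 'I_l) t => d t)) /=.
by apply: big1 => i _; apply: mass_sum1.
Qed.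

Definition iid (T : finType) (d : dist R T) (l : nat) :
  dist R {ffun 'I_l -> T} := Dist (@iid_ge0 T d l) (@iid_sum1 T d l).

End Products.

Definition point_mass (R : realType) (T : finType) (p : T -> R) : Prop :=
  exists t, forall s, p s = (s == t)%:R.

Definition degenerate (R : realType) (U V : finType)
    (rho : dist R (U * V)%type) : Prop :=
  point_mass (fun u => \sum_v rho (u, v)) \/
  point_mass (fun v => \sum_u rho (u, v)).

Definition perf_mass (R : realType) (w : bool * bool) : R :=
  if w.1 == w.2 then 2^-1 else 0.

Lemma perf_ge0 (R : realType) (w : bool * bool) : 0 <= perf_mass R w.
Proof. by rewrite /perf_mass; case: ifP => // _; rewrite invr_ge0 ler0n. Qed.

Lemma perf_sum1 (R : realType) : \sum_w perf_mass R w = 1.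
Proof.
rewrite -(pair_bigA _ (fun a b => perf_mass R (a, b))) /= big_bool !big_bool.
by rewrite /perf_mass /= addr0 add0r -mulr2n -[_ *+ 2]mulr_natr mulVf ?pnatr_eq0.
Qed.

Definition perf (R : realType) : dist R (bool * bool)%type :=
  Dist (@perf_ge0 R) (@perf_sum1 R).

Definition lefts (U V : finType) (l : nat) (w : {ffun 'I_l -> U * V}) :
  {ffun 'I_l -> U} := [ffun i => (w i).1].
Definition rights (U V : finType) (l : nat) (w : {ffun 'I_l -> U * V}) :
  {ffun 'I_l -> V} := [ffun i => (w i).2].

(* Private randomness is an arbitrary finite probability space.  This loses no
   generality: there are finitely many inputs and samples, and a protocol of
   finite cost has finitely many possible messages. *)
Record smp_protocol (R : realType) (U V X Y : finType) (Z : Type) :=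
  SmpProtocol {
    smp_len : nat;
    seedA : finType;
    seedB : finType;
    seedR : finType;
    coinA : dist R seedA;
    coinB : dist R seedB;
    coinR : dist R seedR;
    alice : X -> {ffun 'I_smp_len -> U} -> seedA -> seq bool;
    bob : Y -> {ffun 'I_smp_len -> V} -> seedB -> seq bool;
    referee : seq bool -> seq bool -> seedR -> Z }.

Section SMP.
Variables (R : realType) (U V X Y : finType) (Z : eqType).
Variable rho : dist R (U * V)%type.
Variable P : smp_protocol R U V X Y Z.

Definition smp_space : finType :=
  ({ffun 'I_(smp_len P) -> U * V} * (seedA P * seedB P * seedR P))%type.

Definition smp_dist : dist R smp_space :=
  prod_dist (iid rho (smp_len P))
    (prod_dist (prod_dist (coinA P) (coinB P)) (coinR P)).

Definition msgA (x : X) (w : smp_space) : seq bool :=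
  alice (s := P) x (lefts w.1) w.2.1.1.
Definition msgB (y : Y) (w : smp_space) : seq bool :=
  bob (s := P) y (rights w.1) w.2.1.2.
Definition answer (x : X) (y : Y) (w : smp_space) : Z :=
  referee (s := P) (msgA x w) (msgB y w) w.2.2.

Definition has_error (f : X -> Y -> option Z) (delta : R) : Prop :=
  forall x y z, f x y = Some z ->
    1 - delta <= Pr smp_dist (fun w => answer x y w == z).

(* Only executions of positive probability count as possible. *)
Definition smp_cost : nat :=
  (\max_(x : X) \max_(y : Y) \max_(w : smp_space | (0 < smp_dist w)%R)
     (size (msgA x w) + size (msgB y w)))%N.

End SMP.

(* The extended-real infimum is a minimum as soon as some protocol exists, and
   +oo otherwise; it never takes a junk finite value. *)
Definition SMP (R : realType) (U V X Y : finType) (Z : eqType)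
    (rho : dist R (U * V)%type) (f : X -> Y -> option Z) : \bar R :=
  ereal_inf [set c | exists P : smp_protocol R U V X Y Z,
    (exists2 delta : R, delta < 3^-1 & has_error rho P f delta) /\
    c = ((smp_cost rho P)%:R)%:E].

Record col_protocol (R : realType) (U V : finType) (n : nat) :=
  ColProtocol {
    col_len : nat;
    cseedA : finType;
    cseedB : finType;
    ccoinA : dist R cseedA;
    ccoinB : dist R cseedB;
    csetA : {ffun 'I_col_len -> U} -> cseedA -> {set 'I_n};
    csetB : {ffun 'I_col_len -> V} -> cseedB -> {set 'I_n} }.

Section Collision.
Variables (R : realType) (U V : finType) (n : nat).
Variable rho : dist R (U * V)%type.
Variable P : col_protocol R U V n.

Definition col_space : finType :=
  ({ffun 'I_(col_len P) -> U * V} * (cseedA P * cseedB P))%type.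

Definition col_dist : dist R col_space :=
  prod_dist (iid rho (col_len P)) (prod_dist (ccoinA P) (ccoinB P)).

Definition outA (w : col_space) : {set 'I_n} :=
  csetA (c := P) (lefts w.1) w.2.1.
Definition outB (w : col_space) : {set 'I_n} :=
  csetB (c := P) (rights w.1) w.2.2.

Definition is_collision (p : R) : Prop :=
  forall i : 'I_n, p <= Pr col_dist (fun w => i \in outA w :&: outB w).

Definition col_complexity : nat :=
  (\max_(w : col_space | (0 < col_dist w)%R) maxn #|outA w| #|outB w|)%N.

End Collision.

Definition collp (R : realType) (U V : finType) (rho : dist R (U * V)%type)
    (n : nat) (p : R) : \bar R :=
  ereal_inf [set c | exists P : col_protocol R U V n,
    is_collision rho P p /\ c = ((col_complexity rho P)%:R)%:E].

Definition coll (R : realType) (U V : finType) (rho : dist R (U * V)%type)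
    (n : nat) : \bar R := collp rho n n%:R^-1.

Definition dot2 (m : nat) (a b : 'rV['F_2]_m) : 'F_2 :=
  \sum_(j < m) a 0 j * b 0 j.

Definition count_dot (n m : nat) (x y : {ffun 'I_n -> 'rV['F_2]_m})
    (a : 'F_2) : nat := #|[set i : 'I_n | dot2 (x i) (y i) == a]|.

(* [false], [true] and [None] stand for 0, 1 and outside the promise.  For
   [0 < n] the two thresholds exclude each other. *)
Definition gapip (n m : nat) (x y : {ffun 'I_n -> 'rV['F_2]_m}) :
    option bool :=
  if (2 * n <= 3 * count_dot x y 0%R)%N then Some false
  else if (2 * n <= 3 * count_dot x y 1%R)%N then Some true
  else None.

(* [trunc_log 2 n] is exactly log n when n is a power of two. *)
Definition GAPIP (n : nat) :=
  @gapip n (8 * trunc_log 2 n)%N.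

Definition log2 (R : realType) (x : R) : R := ln x / ln 2.

Definition polylog_le (R : realType) (C : R) (k n : nat) (X Y : \bar R) :
    Prop :=
  (X <= (C * (1 + log2 n%:R) ^+ k)%:E * Y)%E.

(* Main.v *)
(* A collision protocol is run on many independent slots, one slot for each
   pair of an index [i] and a repetition number; the slot decides only whether
   [i] is announced.  The total size is then controlled by Markov's inequality
   while the hits are independent, each of probability 1/n after Alice's private
   downsampling.  Hence the referee receives, for a few independent indices, both
   players' messages at that index, and a majority vote recovers any value that
   is right at two thirds of the indices.  For GAPIP the message at [i] is the
   [i]-th vector.  For a general f, Newman's argument replaces the perfectly
   shared randomness by n fixed blocks of samples, of which all but n/3 give the
   right majority answer on every input.

   Conversely, fix a protocol of cost c for GAPIP and feed it uniform vectors.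
   Call coordinate [k] revealed if the message raises the likelihood of the
   [k]-th vector, given the previous ones, by a factor at least 16; on average
   O(c) coordinates are revealed.  Tilting the distribution at coordinate [k]
   towards inner product b is detected with probability at most that of [k] being
   revealed on both sides, up to O(n^-4).  Tilt, adaptively, exactly at those [k] where
   joint revelation has probability below 1/(24n).  The referee cannot
   distinguish b = 0 from b = 1, so often fewer than 2n/3 coordinates are tilted:
   some fixed prefixes x, y, publicly known, have more than n/3 coordinates that
   are jointly revealed with probability at least 1/(24n).  Testing each of these on
   its own slot, with coordinates beyond [k] drawn privately, gives a collision
   protocol. *)

Require Import Defs.
From HB Require Import structures.
From mathcomp Require Import all_boot all_order all_algebra.
From mathcomp Require Import all_classical all_reals all_analysis.
From mathcomp Require Import ring lra zify.

Set Implicit Arguments.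
Unset Strict Implicit.
Unset Printing Implicit Defensive.

Import Order.TTheory GRing.Theory Num.Theory.
Local Open Scope ring_scope.

(** * Expectation, products and slots *)

Lemma ler_nat_of_bool (R : realType) (b c : bool) :
  (b -> c) -> (b%:R : R) <= c%:R.
Proof. by case: b => // /(_ isT) ->. Qed.

Section Expectation.
Variables (R : realType) (T : finType) (d : dist R T).

Definition Ex (phi : T -> R) : R := \sum_t d t * phi t.

Lemma PrE (E : pred T) : Pr d E = Ex (fun t => (E t)%:R).
Proof.
rewrite /Pr /Ex big_mkcond; apply: eq_bigr => t _.
by case: (E t); rewrite ?mulr1 ?mulr0.
Qed.

Lemma eq_Ex phi psi : phi =1 psi -> Ex phi = Ex psi.
Proof. by move=> e; apply: eq_bigr => t _; rewrite e. Qed.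

(** The comparison is asked only where [d] is positive, because bounds on message and output sizes
    hold only on executions of positive probability. *)
Lemma le_Ex phi psi :
  (forall t, 0 < d t -> phi t <= psi t) -> Ex phi <= Ex psi.
Proof.
move=> le_pp; apply: ler_sum => t _.
have := mass_ge0 d t; rewrite le_eqVlt => /predU1P[<-|dt]; first by rewrite !mul0r.
by rewrite ler_wpM2l ?le_pp // ltW.
Qed.

Lemma eq_Ex_supp phi psi :
  (forall t, 0 < d t -> phi t = psi t) -> Ex phi = Ex psi.
Proof.
by move=> e; apply/eqP; rewrite eq_le !le_Ex // => t /e ->.
Qed.

Lemma Ex_cst c : Ex (fun=> c) = c.
Proof. by rewrite /Ex -mulr_suml mass_sum1 mul1r. Qed.

Lemma ExD phi psi : Ex (fun t => phi t + psi t) = Ex phi + Ex psi.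
Proof. by rewrite /Ex -big_split; apply: eq_bigr => t _; rewrite mulrDr. Qed.

Lemma ExZ c phi : Ex (fun t => c * phi t) = c * Ex phi.
Proof. by rewrite /Ex mulr_sumr; apply: eq_bigr => t _; rewrite mulrCA. Qed.

Lemma ExZr c phi : Ex (fun t => phi t * c) = Ex phi * c.
Proof. by rewrite mulrC -ExZ; apply: eq_Ex => t; rewrite mulrC. Qed.

Lemma ExN phi : Ex (fun t => - phi t) = - Ex phi.
Proof. by rewrite -mulN1r -ExZ; apply: eq_Ex => t; rewrite mulN1r. Qed.

Lemma ExB phi psi : Ex (fun t => phi t - psi t) = Ex phi - Ex psi.
Proof. by rewrite ExD ExN. Qed.

Lemma Ex_sum (I : Type) (r : seq I) (P : pred I) (F : I -> T -> R) :
  Ex (fun t => \sum_(i <- r | P i) F i t) = \sum_(i <- r | P i) Ex (F i).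
Proof.
rewrite /Ex exchange_big; apply: eq_bigr => t _ /=.
by rewrite mulr_sumr.
Qed.

Lemma Ex_ge0 phi : (forall t, 0 < d t -> 0 <= phi t) -> 0 <= Ex phi.
Proof. by move=> h; rewrite -[leLHS](Ex_cst 0) le_Ex. Qed.

(** The probabilistic method. The witness has positive mass, so the cost bounds apply to it. *)
Lemma Ex_gt_witness phi c :
  c < Ex phi -> exists2 t, 0 < d t & c < phi t.
Proof.
move=> h; apply: contrapT => nex.
have : Ex phi <= c.
  rewrite -[leRHS](Ex_cst c) le_Ex // => t dt; rewrite leNgt; apply/negP => ct.
  by apply: nex; exists t.
by rewrite leNgt h.
Qed.

Lemma normr_Ex phi : `|Ex phi| <= Ex (fun t => `|phi t|).
Proof.
apply: le_trans (ler_norm_sum _ _ _) _; apply: ler_sum => t _.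
by rewrite normrM (ger0_norm (mass_ge0 _ _)).
Qed.

End Expectation.

Lemma Ex_exchange (R : realType) (S T : finType) (d : dist R S) (e : dist R T)
    (phi : S -> T -> R) :
  Ex d (fun s => Ex e (phi s)) = Ex e (fun t => Ex d (phi ^~ t)).
Proof.
rewrite /Ex; under eq_bigr do rewrite mulr_sumr.
rewrite exchange_big; apply: eq_bigr => t _; rewrite mulr_sumr.
by apply: eq_bigr => s _; rewrite mulrCA.
Qed.

Lemma Ex_prod_dist (R : realType) (S T : finType) (d : dist R S) (e : dist R T)
    (phi : S * T -> R) :
  Ex (prod_dist d e) phi = Ex d (fun s => Ex e (fun t => phi (s, t))).
Proof.
rewrite /Ex; under [RHS]eq_bigr do rewrite mulr_sumr.
by rewrite pair_bigA; apply: eq_bigr => -[s t] _ /=; rewrite mulrA.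
Qed.

Section Pushforward.
Variables (R : realType) (S T : finType) (d : dist R S) (e : dist R T).

Lemma Ex_reindex (h : S -> T) (phi : T -> R) :
  {on predT, bijective h} -> (forall s, d s = e (h s)) ->
  Ex e phi = Ex d (phi \o h).
Proof.
move=> bh dh; rewrite /Ex (reindex h) //=.
by apply: eq_bigr => s _; rewrite dh.
Qed.

End Pushforward.

Section ProductDistribution.
Variables (R : realType) (I T : finType) (d : I -> dist R T).

Lemma pdist_ge0 (w : {ffun I -> T}) : 0 <= \prod_i d i (w i).
Proof. by apply: prodr_ge0 => i _; apply: mass_ge0. Qed.

Lemma pdist_sum1 : \sum_(w : {ffun I -> T}) \prod_i d i (w i) = 1.
Proof.
rewrite -(bigA_distr_bigA (fun i t => d i t)) /=.
by apply: big1 => i _; apply: mass_sum1.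
Qed.

Definition pdist : dist R {ffun I -> T} := Dist pdist_ge0 pdist_sum1.

Lemma Ex_pdist_prod (phi : I -> T -> R) :
  Ex pdist (fun w => \prod_i phi i (w i)) = \prod_i Ex (d i) (phi i).
Proof.
rewrite /Ex (bigA_distr_bigA (fun i t => d i t * phi i t)) /=.
by apply: eq_bigr => w _; rewrite big_split.
Qed.

Lemma Ex_pdist_coord i (phi : T -> R) :
  Ex pdist (fun w => phi (w i)) = Ex (d i) phi.
Proof.
pose psi k t : R := if k == i then phi t else 1.
transitivity (Ex pdist (fun w => \prod_k psi k (w k))).
  apply: eq_Ex => w; rewrite (bigD1 i) //= /psi eqxx big1 ?mulr1 //.
  by move=> k /negPf ->.
rewrite Ex_pdist_prod (bigD1 i) //= big1 ?mulr1 => [|k ki].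
  by apply: eq_Ex => t; rewrite /psi eqxx.
by rewrite -[RHS](Ex_cst (d k)); apply: eq_Ex => t; rewrite /psi (negPf ki).
Qed.

Lemma Ex_pdist_indep i j (phi psi : T -> R) : i != j ->
  Ex pdist (fun w => phi (w i) * psi (w j)) = Ex (d i) phi * Ex (d j) psi.
Proof.
move=> nij.
pose chi k t : R := if k == i then phi t else if k == j then psi t else 1.
transitivity (Ex pdist (fun w => \prod_k chi k (w k))).
  apply: eq_Ex => w; rewrite (bigD1 i) //= (bigD1 j) 1?eq_sym //= /chi !eqxx.
  rewrite eq_sym (negPf nij) big1 ?mulr1 //.
  by move=> k /andP[/negPf -> /negPf ->].
rewrite Ex_pdist_prod (bigD1 i) //= (bigD1 j) 1?eq_sym //= big1 ?mulr1.
  congr (_ * _); apply: eq_Ex => t; rewrite /chi eqxx //.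
  by rewrite eq_sym (negPf nij).
move=> k /andP[/negPf ki /negPf kj].
by rewrite -[RHS](Ex_cst (d k)); apply: eq_Ex => t; rewrite /chi ki kj.
Qed.

Lemma pdist_gt0 w i : 0 < pdist w -> 0 < d i (w i).
Proof.
move=> wgt0; rewrite lt_neqAle mass_ge0 andbT; apply/eqP => w0.
by move: wgt0; rewrite /= (bigD1 i) //= -w0 mul0r ltxx.
Qed.

End ProductDistribution.

Lemma unif_ge0 (R : realType) (T : finType) (t : T) : 0 <= (#|T|%:R : R)^-1.
Proof. by rewrite invr_ge0. Qed.

Lemma unif_sum1 (R : realType) (T : finType) (t0 : T) :
  \sum_(t : T) (#|T|%:R : R)^-1 = 1.
Proof.
rewrite sumr_const -[LHS]mulr_natr mulVf // pnatr_eq0.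
by rewrite -lt0n; apply/card_gt0P; exists t0.
Qed.

Definition unif (R : realType) (T : finType) (t0 : T) : dist R T :=
  Dist (@unif_ge0 R T) (unif_sum1 R t0).

(* Independent slots: a tuple of [#|J| * l] samples is read as a [J]-indexed
   family of tuples of [l] samples. *)
Section Slots.
Variables (R : realType) (U V J SA SB : finType) (rho : dist R (U * V)%type).
Variables (l : nat) (dA : J -> dist R SA) (dB : J -> dist R SB).

(** The flat samples are read as a matrix with one row per slot. *)
Definition slot_idx (j : J) (k : 'I_l) : 'I_(#|J| * l) :=
  mxvec_index (enum_rank j) k.

Definition slot_samples (W : Type) (w : {ffun 'I_(#|J| * l) -> W}) (j : J) :
  {ffun 'I_l -> W} := [ffun k => w (slot_idx j k)].

Definition slot_space : finType :=
  ({ffun 'I_l -> U * V} * (SA * SB))%type.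

Definition slot_dist (j : J) : dist R slot_space :=
  prod_dist (iid rho l) (prod_dist (dA j) (dB j)).

Definition slots_space : finType :=
  ({ffun 'I_(#|J| * l) -> U * V} * ({ffun J -> SA} * {ffun J -> SB}))%type.

Definition slots_dist : dist R slots_space :=
  prod_dist (iid rho (#|J| * l)) (prod_dist (pdist dA) (pdist dB)).

Definition slots_of (w : slots_space) : {ffun J -> slot_space} :=
  [ffun j => (slot_samples w.1 j, (w.2.1 j, w.2.2 j))].

Lemma slot_idx_bij : bijective (fun jk : J * 'I_l => slot_idx jk.1 jk.2).
Proof.
have [g gK gK'] := curry_mxvec_bij #|J| l.
exists (fun i => (enum_val (g i).1, (g i).2)) => [[j k]|i] /=.
  rewrite /slot_idx; have := gK (enum_rank j, k) isT.
  by rewrite /uncurry => -> /=; rewrite enum_rankK.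
rewrite /slot_idx /= enum_valK.
by have := gK' i isT; rewrite /uncurry; case: (g i).
Qed.

Lemma slots_of_bij : bijective slots_of.
Proof.
have [g gK gK'] := slot_idx_bij.
pose back (b : {ffun J -> slot_space}) : slots_space :=
  ([ffun i => (b (g i).1).1 (g i).2], ([ffun j => (b j).2.1], [ffun j => (b j).2.2])).
exists back => [[w [a b]]|b]; rewrite /back /slots_of /=.
  congr (_, (_, _)); apply/ffunP => i; rewrite !ffunE /= ?ffunE //.
  by congr (w _); exact: gK'.
apply/ffunP => j; rewrite !ffunE /=; case bj: (b j) => [w [sa sb]] /=.
congr (_, _); apply/ffunP => k; rewrite !ffunE.
by rewrite (gK (j, k)) /= bj.
Qed.

Lemma slots_distE w : slots_dist w = pdist slot_dist (slots_of w).
Proof.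
case: w => w [a b] /=; rewrite (reindex _ (onW_bij predT slot_idx_bij)) /=.
rewrite -(pair_bigA _ (fun j k => rho (w (slot_idx j k)))) /= -!big_split /=.
apply: eq_bigr => j _; rewrite ffunE /=; congr (_ * _).
by apply: eq_bigr => k _; rewrite ffunE.
Qed.

(** Multi-slot protocols run on [slots_dist], while their probabilities are computed under
    [pdist slot_dist], where the slots are independent by construction; this is the bridge. *)
Lemma Ex_slots (phi : {ffun J -> slot_space} -> R) :
  Ex slots_dist (phi \o slots_of) = Ex (pdist slot_dist) phi.
Proof.
rewrite (@Ex_reindex _ _ _ slots_dist (pdist slot_dist) slots_of) //.
  exact: onW_bij slots_of_bij.
exact: slots_distE.
Qed.

End Slots.

Lemma lefts_slot (U V J : finType) l (w : {ffun 'I_(#|J| * l) -> U * V}) (j : J) :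
  slot_samples (lefts w) j = lefts (slot_samples w j).
Proof. by apply/ffunP => k; rewrite !ffunE. Qed.

Lemma rights_slot (U V J : finType) l (w : {ffun 'I_(#|J| * l) -> U * V}) (j : J) :
  slot_samples (rights w) j = rights (slot_samples w j).
Proof. by apply/ffunP => k; rewrite !ffunE. Qed.

(** * Collision protocols from independent tests *)

Lemma card_sum_mem (R : realType) (T : finType) (A : {set T}) (a : T -> bool) :
  A =i a -> (#|A|%:R : R) = \sum_t (a t)%:R.
Proof.
move=> Aa; rewrite -natr_sum -sum1_card big_mkcond /=; congr (_%:R).
by apply: eq_bigr => t _; rewrite Aa unfold_in; case: (a t).
Qed.

Lemma one_sub_prod_le_ex (R : realType) (I : finType) (h : I -> bool) :
  (1 : R) - \prod_i (1 - (h i)%:R) <= [exists i, h i]%:R.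
Proof.
case: existsP => [[i hi]|nh]; last first.
  by rewrite big1 ?subrr // => i _; case: (boolP (h i)) => [hi|_];
     [case: nh; exists i | rewrite subr0].
by rewrite (bigD1 i) //= hi subrr mul0r subr0.
Qed.

Section CollisionSlots.
Variables (R : realType) (U V : finType) (rho : dist R (U * V)%type) (n : nat).

(** Each player outputs the union of its sets over [T] independent runs: [i] is missed only if every
    run misses it, and the sizes add up. *)
Lemma col_amplify (P : col_protocol R U V n) (T : nat) (p : R) :
  0 <= p <= 1 -> is_collision rho P p ->
  exists Q : col_protocol R U V n,
    is_collision rho Q (1 - (1 - p) ^+ T) /\
    (col_complexity rho Q <= T * col_complexity rho P)%N.
Proof.
move=> /andP[p0 p1] colP.
pose dA (j : 'I_T) := ccoinA P; pose dB (j : 'I_T) := ccoinB P.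
pose sd := pdist (slot_dist rho (col_len P) dA dB).
pose Q : col_protocol R U V n := {| ccoinA := pdist dA; ccoinB := pdist dB;
  csetA := fun u s => \bigcup_(j < T) csetA (c := P) (slot_samples u j) (s j);
  csetB := fun v s => \bigcup_(j < T) csetB (c := P) (slot_samples v j) (s j) |}.
have QA w : outA (P := Q) w = \bigcup_(j < T) outA (P := P) (slots_of w j).
  by apply: eq_bigr => j _; rewrite /outA /= lefts_slot /slots_of ffunE.
have QB w : outB (P := Q) w = \bigcup_(j < T) outB (P := P) (slots_of w j).
  by apply: eq_bigr => j _; rewrite /outB /= rights_slot /slots_of ffunE.
exists Q; split=> [i|].
  pose hit b := i \in outA (P := P) b :&: outB (P := P) b.
  pose h (b : {ffun 'I_T -> slot_space U V _ _ _}) : R :=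
    1 - \prod_j (1 - (hit (b j))%:R).
  apply: (@le_trans _ _ (Ex sd h)).
    rewrite /h ExB Ex_cst lerB // /sd.
    rewrite (Ex_pdist_prod _ (fun=> (fun b => 1 - (hit b)%:R))) /=.
    rewrite -[in leRHS](card_ord T) -prodr_const; apply: ler_prod => j _.
    rewrite ExB Ex_cst -PrE lerB ?colP // subr_ge0 andbT.
    rewrite PrE -[leRHS](Ex_cst (slot_dist rho (col_len P) dA dB j)) le_Ex // => b _.
    by rewrite lern1 leq_b1.
  rewrite PrE /sd -Ex_slots; apply: le_Ex => w _.
  apply: le_trans (one_sub_prod_le_ex _ _) _.
  apply: ler_nat_of_bool => /existsP[j].
  rewrite QA QB /hit !inE => /andP[ia ib].
  by apply/andP; split; apply/bigcupP; exists j.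
rewrite /col_complexity; apply/bigmax_leqP => w w0.
have slot0 j : 0 < slot_dist rho (col_len P) dA dB j (slots_of w j).
  by apply: pdist_gt0; rewrite -slots_distE.
have bnd j : (maxn #|outA (P := P) (slots_of w j)| #|outB (P := P) (slots_of w j)|
    <= col_complexity rho P)%N.
  exact: (@leq_bigmax_cond (col_space P) (fun v => 0 < col_dist rho P v)
    (fun v => maxn #|outA v| #|outB v|) (slots_of w j) (slot0 j)).
have cardU (F : 'I_T -> {set 'I_n}) c : (forall j, #|F j| <= c)%N ->
    (#|\bigcup_j F j| <= T * c)%N.
  move=> le_c; apply: leq_trans (_ : \sum_j #|F j| <= _)%N; last first.
    by rewrite -[T in leqRHS]card_ord -sum_nat_const leq_sum.
  elim/big_ind2: _ => [|A a B b leA leB|//]; first by rewrite cards0.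
  by apply: leq_trans (leq_card_setU _ _) _; apply: leq_add.
rewrite geq_max QA QB !cardU // => j.
  exact: leq_trans (leq_maxr _ _) (bnd j).
exact: leq_trans (leq_maxl _ _) (bnd j).
Qed.

Variables (l : nat) (SA SB : finType) (dA : dist R SA) (dB : dist R SB).
Variables (a : 'I_n -> {ffun 'I_l -> U} -> SA -> bool).
Variables (b : 'I_n -> {ffun 'I_l -> V} -> SB -> bool).

Let base := slot_dist rho l (fun _ : 'I_n => dA) (fun _ : 'I_n => dB).

(* Element [i] is tested on its own independent slot, which makes the tests
   for different elements independent; so conditioning on [i] being hit
   increases the expected output size by at most 1, and truncating the output
   costs at most half of the collision probability. *)
Lemma col_of_tests (p E : R) (cap : nat) :
  (forall i, p <= Ex (base i) (fun w => (a i (lefts w.1) w.2.1 &&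
                                         b i (rights w.1) w.2.2)%:R)) ->
  \sum_i Ex (base i) (fun w => (a i (lefts w.1) w.2.1)%:R) <= E ->
  \sum_i Ex (base i) (fun w => (b i (rights w.1) w.2.2)%:R) <= E ->
  4 * (1 + E) <= cap%:R ->
  exists Q : col_protocol R U V n,
    is_collision rho Q (p / 2) /\ (col_complexity rho Q <= cap)%N.
Proof.
move=> lep leA leB lecap.
have E0 : 0 <= E by apply: le_trans leA; apply: sumr_ge0 => i _; apply: Ex_ge0.
have cap0 : 0 < cap%:R :> R by apply: lt_le_trans lecap; lra.
pose setA u (s : {ffun 'I_n -> SA}) := [set i : 'I_n | a i (slot_samples u i) (s i)].
pose setB v (s : {ffun 'I_n -> SB}) := [set i : 'I_n | b i (slot_samples v i) (s i)].
(* An oversized set is dropped entirely, so the size bound holds on every execution. *)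
pose trunc (A : {set 'I_n}) := if (#|A| <= cap)%N then A else finset.set0.
pose Q : col_protocol R U V n := {| ccoinA := pdist (fun=> dA);
  ccoinB := pdist (fun=> dB);
  csetA := fun u s => trunc (setA u s); csetB := fun v s => trunc (setB v s) |}.
have lt_trunc A : (#|trunc A| <= cap)%N by rewrite /trunc; case: ifP; rewrite ?cards0.
exists Q; split=> [i|]; last first.
  by apply/bigmax_leqP => w _; rewrite geq_max !lt_trunc.
pose ta j (w : slot_space U V SA SB l) := a j (lefts w.1) w.2.1.
pose tb j (w : slot_space U V SA SB l) := b j (rights w.1) w.2.2.
pose hit j w : R := (ta j w && tb j w)%:R.
(* The expected size on the event that [i] is hit: test [i] itself adds at most 1, and the other
   tests are independent of that event. *)
have hit_le t : (forall j w, hit j w * (t j w)%:R <= hit j w) ->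
    \sum_j Ex (base j) (fun w => (t j w)%:R) <= E ->
    Ex (pdist base) (fun w => hit i (w i) * \sum_j (t j (w j))%:R) <=
      Ex (base i) (hit i) * (1 + E).
  move=> ht leE; under eq_Ex do rewrite mulr_sumr.
  rewrite Ex_sum (bigD1 i) //= mulrDr mulr1 lerD //.
    rewrite (Ex_pdist_coord base i (fun w => hit i w * (t i w)%:R)).
    by apply: le_Ex => w _.
  apply: (@le_trans _ _ (\sum_(j | j != i)
      Ex (base i) (hit i) * Ex (base j) (fun w => (t j w)%:R))).
    apply: ler_sum => j ji.
    by rewrite (Ex_pdist_indep base (hit i) (fun w => (t j w)%:R)) // eq_sym.
  rewrite -mulr_sumr ler_wpM2l ?Ex_ge0 //.
  apply: le_trans leE; rewrite [leRHS](bigD1 i) //= lerDr.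
  exact: Ex_ge0.
have hitA := hit_le ta _ leA; have hitB := hit_le tb _ leB.
(* The factor in brackets is a lower bound for the indicator that neither set overflows. Both sums
   together lose at most 2 (1 + E) / cap, that is, half of the hit probability. *)
have pi2 : Ex (base i) (hit i) / 2 <= Ex (pdist base) (fun w => hit i (w i) *
    (1 - (\sum_j (ta j (w j))%:R + \sum_j (tb j (w j))%:R) / cap%:R)).
  under [leRHS]eq_Ex => w do rewrite mulrBr mulr1 mulrA mulrDr.
  rewrite ExB ExZr ExD (Ex_pdist_coord base i (hit i)).
  set H := Ex (base i) (hit i).
  have H0 : 0 <= H by apply: Ex_ge0.
  set x := Ex _ _; set y := Ex _ _.
  have lex : x <= H * (1 + E).
    apply: hitA => j w; rewrite /hit; case: (ta j w); case: (tb j w);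
    by rewrite ?mulr1 ?mulr0 ?mul0r.
  have ley : y <= H * (1 + E).
    apply: hitB => j w; rewrite /hit; case: (ta j w); case: (tb j w);
    by rewrite ?mulr1 ?mulr0 ?mul0r.
  suff : (x + y) / cap%:R <= H / 2 by lra.
  rewrite ler_pdivrMr //; nra.
apply: (@le_trans _ _ (Ex (base i) (hit i) / 2)).
  by rewrite ler_pM2r ?invr_gt0 //; apply: lep.
apply: le_trans pi2 _; rewrite PrE -Ex_slots; apply: le_Ex => w _ /=.
have cardA : (#|setA (lefts w.1) w.2.1|%:R : R) = \sum_j (ta j (slots_of w j))%:R.
  by apply: card_sum_mem => j; rewrite !inE unfold_in /ta /slots_of ffunE lefts_slot.
have cardB : (#|setB (rights w.1) w.2.2|%:R : R) = \sum_j (tb j (slots_of w j))%:R.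
  by apply: card_sum_mem => j; rewrite !inE unfold_in /tb /slots_of ffunE rights_slot.
rewrite -cardA -cardB /outA /outB /= /trunc.
case: (leqP #|setA _ _| cap) => [_|ltA]; last first.
  apply: (@le_trans _ _ 0); last by rewrite ler0n.
  rewrite mulr_ge0_le0 // subr_le0 ler_pdivlMr // mul1r.
  apply: (@le_trans _ _ #|setA (lefts w.1) w.2.1|%:R); first by rewrite ler_nat ltnW.
  by rewrite lerDl.
case: (leqP #|setB _ _| cap) => [_|ltB]; last first.
  apply: (@le_trans _ _ 0); last by rewrite ler0n.
  rewrite mulr_ge0_le0 // subr_le0 ler_pdivlMr // mul1r.
  apply: (@le_trans _ _ #|setB (rights w.1) w.2.2|%:R); first by rewrite ler_nat ltnW.
  by rewrite lerDr.
apply: (@le_trans _ _ (hit i (slots_of w i))).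
  rewrite ler_piMr // lerBlDr lerDl divr_ge0 //; exact: addr_ge0.
by rewrite !inE /hit /ta /tb /slots_of ffunE lefts_slot rights_slot.
Qed.

End CollisionSlots.

(** * Rectangle bound *)

Lemma ln_ge1BV (R : realType) (y : R) : 0 < y -> 1 - y^-1 <= ln y.
Proof.
move=> y0; have yV0 : 0 < y^-1 by rewrite invr_gt0.
have := @le_ln1Dx R (y^-1 - 1); rewrite [1 + _]addrC subrK lnV ?posrE // => h.
by rewrite -lerN2 opprB; apply: h; lra.
Qed.

(** The right side is nonnegative for every positive [y], and from 16 on it is at least 1 because ln
    16 = 4 ln 2 and ln 2 >= 1/2. This fixes the revelation threshold. *)
Lemma ind_ge16_le (R : realType) (y : R) : 0 < y ->
  ((16 <= y)%R%:R : R) <= ln y + y^-1 - 1.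
Proof.
move=> y0; have lny := ln_ge1BV y0; case: (lerP 16 y) => y16 /=; last by lra.
have : ln (16 : R) <= ln y by rewrite ler_ln ?posrE ?ltr0n.
have -> : (16 : R) = 2 ^+ 4 by ring.
rewrite lnXn //; have := @ln_ge1BV R 2 ltac:(lra).
have : 0 < y^-1 by rewrite invr_gt0.
by lra.
Qed.

Section Rectangle.
Variables (R : realType) (G : finType).
Implicit Types (s : G -> G -> R).

(** [lam] bounds the square of the spectral norm of the matrix [s]. *)
Definition op_bounded s (lam : R) := forall h : G -> R,
  \sum_b (\sum_a h a * s a b) ^+ 2 <= lam * \sum_a h a ^+ 2.

Variables (lam tau r : R).
Hypotheses (lam0 : 0 <= lam) (tau0 : 0 <= tau) (r0 : 0 < r).
Hypothesis rE : r ^+ 2 = lam * tau.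

Let N : R := #|G|%:R.

(** Cauchy-Schwarz, done as AM-GM with weight [r * q]. When [q] is 0 this weight vanishes, but so
    does every term. *)
Lemma sum_norm_le s (h : G -> R) (q : R) :
  op_bounded s lam -> 0 <= q -> \sum_a h a ^+ 2 <= tau * N * q ^+ 2 ->
  \sum_b `|\sum_a h a * s a b| <= N * r * q.
Proof.
move=> sb q0 hq; set v := fun b => \sum_a h a * s a b.
have v2 : \sum_b v b ^+ 2 <= N * (r * q) ^+ 2.
  apply: le_trans (sb h) _; rewrite exprMn rE.
  apply: le_trans (ler_wpM2l lam0 hq) _; rewrite le_eqVlt; apply/orP; left.
  by apply/eqP; ring.
move: q0 v2; rewrite le_eqVlt => /predU1P[<- v2|q0 v2].
  rewrite mulr0 big1 // => b _; apply/normr0P; rewrite -/(v b) -sqrf_eq0.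
  rewrite eq_le sqr_ge0 andbT; apply: le_trans (_ : \sum_b v b ^+ 2 <= _).
    by rewrite (bigD1 b) //= lerDl sumr_ge0 // => ? _; rewrite sqr_ge0.
  by apply: le_trans v2 _; rewrite mulr0 expr0n mulr0.
have t0 : 0 < r * q by rewrite mulr_gt0.
rewrite -(ler_pM2r t0) mulr_suml.
apply: (@le_trans _ _ (\sum_b (v b ^+ 2 + (r * q) ^+ 2) / 2)).
  apply: ler_sum => b _; rewrite -/(v b) -(real_normK (num_real (v b))).
  have := sqr_ge0 (`|v b| - r * q); rewrite sqrrB; lra.
rewrite -mulr_suml big_split /= sumr_const -mulr_natl -/N.
rewrite ler_pdivrMr //; have := v2; lra.
Qed.

(** If one side has small second moments for each message, the spectral bound controls the signed
    sum for that message. The other side enters only through weights of total at most 1. *)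
Lemma one_sided_bias (M M' : finType) s (c : M -> M' -> R) (h : M -> G -> R) (g : M' -> G -> R)
    (q : M -> R) :
  op_bounded s lam -> (forall m m', `|c m m'| <= 1) ->
  (forall m' b, 0 <= g m' b) -> (forall b, \sum_m' g m' b <= 1) ->
  (forall m, 0 <= q m) -> \sum_m q m <= 1 ->
  (forall m, \sum_a h m a ^+ 2 <= tau * N * q m ^+ 2) ->
  `|\sum_a \sum_b s a b * \sum_m \sum_m' c m m' * (h m a * g m' b)| <= N * r.
Proof.
move=> sb c1 g0 g1 q0 q1 hq.
have -> : \sum_a \sum_b s a b * \sum_m \sum_m' c m m' * (h m a * g m' b) =
    \sum_m \sum_b \sum_m' (c m m' * g m' b) * (\sum_a h m a * s a b).
  under eq_bigr => a _ do under eq_bigr => b _ do rewrite mulr_sumr.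
  under eq_bigr => a _ do rewrite exchange_big /=.
  rewrite exchange_big; apply: eq_bigr => m _ /=.
  rewrite exchange_big; apply: eq_bigr => b _ /=.
  under eq_bigr => a _ do rewrite mulr_sumr.
  rewrite exchange_big; apply: eq_bigr => m' _ /=.
  by rewrite mulr_sumr; apply: eq_bigr => a _; ring.
apply: le_trans (ler_norm_sum _ _ _) _.
apply: (@le_trans _ _ (\sum_m N * r * q m)); last first.
  by rewrite -mulr_sumr ler_piMr // mulr_ge0 // ltW.
apply: ler_sum => m _; apply: le_trans (sum_norm_le sb (q0 m) (hq m)).
apply: le_trans (ler_norm_sum _ _ _) _; apply: ler_sum => b _.
apply: le_trans (ler_norm_sum _ _ _) _.
apply: (@le_trans _ _ (\sum_m' g m' b * `|\sum_a h m a * s a b|)).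
  apply: ler_sum => m' _; rewrite !normrM ler_wpM2r //.
  by rewrite (ger0_norm (g0 _ _)) ler_piMl.
by rewrite -mulr_suml ler_piMl.
Qed.

(** On the light part [f] stays below [tau * q], so its square is at most [tau * q * f]. *)
Lemma sum_sqr_light (f : G -> R) (q : R) : (forall a, 0 <= f a) ->
  \sum_a f a = N * q -> 0 <= q ->
  \sum_a (f a * (~~ (tau * q <= f a)%R)%:R) ^+ 2 <= tau * N * q ^+ 2.
Proof.
move=> f0 fq q0; apply: (@le_trans _ _ (\sum_a tau * q * f a)); last first.
  by rewrite -mulr_sumr fq le_eqVlt; apply/orP; left; apply/eqP; ring.
apply: ler_sum => a _; case: (lerP (tau * q) (f a)) => [_|lt_f] /=; last first.
  by rewrite mulr1 expr2 ler_wpM2r // ltW.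
by rewrite mulr0 expr0n mulr_ge0 // mulr_ge0.
Qed.

(** Split [f = fA + h] and [g = gA + k] into heavy and light parts, so that
    [f g = fA gA + h g + fA k]. The heavy product is bounded trivially; each of the other terms has
    a light factor and costs [N * r] by [one_sided_bias], once for each orientation of [s]. *)
Lemma rectangle_bias (M M' : finType) s (c : M -> M' -> R) (f : M -> G -> R) (g : M' -> G -> R)
    (q : M -> R) (q' : M' -> R) :
  op_bounded s lam -> op_bounded (fun a b => s b a) lam ->
  (forall a b, `|s a b| <= 1) -> (forall m m', `|c m m'| <= 1) ->
  (forall m a, 0 <= f m a) -> (forall a, \sum_m f m a <= 1) ->
  (forall m b, 0 <= g m b) -> (forall b, \sum_m g m b <= 1) ->
  (forall m, \sum_a f m a = N * q m) -> (forall m, \sum_a g m a = N * q' m) ->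
  (forall m, 0 <= q m) -> (forall m, 0 <= q' m) ->
  \sum_m q m <= 1 -> \sum_m q' m <= 1 ->
  `|\sum_a \sum_b s a b * \sum_m \sum_m' c m m' * (f m a * g m' b)| <=
  \sum_a \sum_b \sum_m \sum_m' (tau * q m <= f m a)%R%:R * f m a *
     ((tau * q' m' <= g m' b)%R%:R * g m' b) + 2 * (N * r).
Proof.
move=> sb sb' s1 c1 f0 f1 g0 g1 fq gq q0 q'0 q1 q'1.
pose fA m a := (tau * q m <= f m a)%R%:R * f m a.
pose gA m b := (tau * q' m <= g m b)%R%:R * g m b.
pose h m a := f m a * (~~ (tau * q m <= f m a)%R)%:R.
pose k m b := g m b * (~~ (tau * q' m <= g m b)%R)%:R.
have fE m a : f m a = fA m a + h m a.
  by rewrite /fA /h; case: (_ <= _); rewrite ?mul1r ?mul0r ?mulr0 ?mulr1 ?addr0 ?add0r.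
have gE m b : g m b = gA m b + k m b.
  by rewrite /gA /k; case: (_ <= _); rewrite ?mul1r ?mul0r ?mulr0 ?mulr1 ?addr0 ?add0r.
have fA0 m a : 0 <= fA m a by rewrite mulr_ge0.
have gA0 m a : 0 <= gA m a by rewrite mulr_ge0.
have h0 m a : 0 <= h m a by rewrite mulr_ge0.
have k0 m a : 0 <= k m a by rewrite mulr_ge0.
have fA1 a : \sum_m fA m a <= 1.
  by apply: le_trans (f1 a); apply: ler_sum => m _; rewrite fE lerDl.
pose S (u : M -> G -> R) (v : M' -> G -> R) :=
  \sum_a \sum_b s a b * \sum_m \sum_m' c m m' * (u m a * v m' b).
have -> : \sum_a \sum_b s a b * \sum_m \sum_m' c m m' * (f m a * g m' b) =
    S fA gA + (S h g + S fA k).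
  rewrite /S -!big_split; apply: eq_bigr => a _ /=.
  rewrite -!big_split; apply: eq_bigr => b _ /=.
  rewrite -!mulrDr -!big_split; congr (_ * _); apply: eq_bigr => m _ /=.
  rewrite -!big_split; apply: eq_bigr => m' _ /=.
  rewrite (fE m a) (gE m' b); ring.
apply: le_trans (ler_normD _ _) _; apply: lerD.
  apply: le_trans (ler_norm_sum _ _ _) _; apply: ler_sum => a _.
  apply: le_trans (ler_norm_sum _ _ _) _; apply: ler_sum => b _.
  rewrite normrM; apply: le_trans (ler_piMl (normr_ge0 _) (s1 a b)) _.
  apply: le_trans (ler_norm_sum _ _ _) _; apply: ler_sum => m _.
  apply: le_trans (ler_norm_sum _ _ _) _; apply: ler_sum => m' _.
  rewrite normrM (ger0_norm (mulr_ge0 (fA0 m a) (gA0 m' b))).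
  exact: ler_piMl (mulr_ge0 _ _) (c1 _ _).
apply: le_trans (ler_normD _ _) _; rewrite mulr_natl mulr2n; apply: lerD.
  apply: (one_sided_bias (q := q)) => // m; exact: sum_sqr_light.
have -> : S fA k = \sum_b \sum_a s a b * \sum_m' \sum_m c m m' * (k m' b * fA m a).
  rewrite /S exchange_big; apply: eq_bigr => b _; apply: eq_bigr => a _ /=.
  rewrite exchange_big; congr (_ * _); apply: eq_bigr => m' _; apply: eq_bigr => m _ /=.
  by congr (_ * _); rewrite mulrC.
apply: (one_sided_bias (s := fun b a => s a b) (c := fun m' m => c m m') (q := q')) => // m.
exact: sum_sqr_light.
Qed.

End Rectangle.

(** * Revealed coordinates *)

Section UniformMeasure.
Variables (R : realType).

Lemma Ex_unif_invol (T : finType) (t0 : T) (h : T -> T) (phi : T -> R) :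
  involutive h -> Ex (unif R t0) phi = Ex (unif R t0) (phi \o h).
Proof.
by move=> hK; apply: Ex_reindex => //; apply: onW_bij; exact: inv_bij.
Qed.

Lemma Ex_unif2_invol (S T : finType) (s0 : S) (t0 : T) (h : S * T -> S * T)
    (phi : S -> T -> R) : involutive h ->
  Ex (unif R s0) (fun s => Ex (unif R t0) (phi s)) =
  Ex (unif R s0) (fun s => Ex (unif R t0) (fun t => phi (h (s, t)).1 (h (s, t)).2)).
Proof.
move=> hK; pose d := prod_dist (unif R s0) (unif R t0).
transitivity (Ex d (fun p => phi p.1 p.2)); first by rewrite Ex_prod_dist.
rewrite (@Ex_reindex _ _ _ d d h) ?Ex_prod_dist //.
by apply: onW_bij; exact: inv_bij.
Qed.

Lemma unif_gt0 (T : finType) (t0 t : T) : 0 < unif R t0 t.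
Proof. by rewrite /= invr_gt0 ltr0n; apply/card_gt0P; exists t. Qed.

Lemma Ex_gt0 (T : finType) (d : dist R T) (phi : T -> R) t :
  (forall t, 0 <= phi t) -> 0 < d t -> 0 < phi t -> 0 < Ex d phi.
Proof.
move=> phi0 dt pt; rewrite /Ex (bigD1 t) //= ltr_pwDl ?mulr_gt0 //.
by apply: sumr_ge0 => s _; rewrite mulr_ge0 ?mass_ge0.
Qed.

Lemma Ex_unif_sum (T : finType) (t0 : T) (phi : T -> R) :
  \sum_t phi t = #|T|%:R * Ex (unif R t0) phi.
Proof.
rewrite /Ex -mulr_sumr mulrA mulfV ?mul1r // pnatr_eq0 -lt0n.
by apply/card_gt0P; exists t0.
Qed.

End UniformMeasure.

Section Words.
Variables (R : realType) (G : finType) (g0 : G) (n : nat).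

Local Notation word := {ffun 'I_n -> G}.
Definition word0 : word := [ffun=> g0].
Local Notation EX := (Ex (unif R word0)).
Local Notation EG := (Ex (unif R g0)).

(** Averaging a function of [mix k x z] over uniform [z] amounts to conditioning on the first [k]
    coordinates of [x]. *)
Definition mix (k : nat) (x z : word) : word :=
  [ffun i : 'I_n => if (i < k)%N then x i else z i].
Definition upd (i : 'I_n) (a : G) (x : word) : word :=
  [ffun j : 'I_n => if j == i then a else x j].

Lemma mix0 x z : mix 0 x z = z.
Proof. by apply/ffunP => i; rewrite ffunE ltn0. Qed.
Lemma mixn x z : mix n x z = x.
Proof. by apply/ffunP => i; rewrite ffunE ltn_ord. Qed.
Lemma mixxx k x : mix k x x = x.
Proof. by apply/ffunP => i; rewrite ffunE if_same. Qed.
Lemma mix_mix k j x z w : (k <= j)%N -> mix k (mix j x z) w = mix k x w.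
Proof.
move=> kj; apply/ffunP => i; rewrite !ffunE; case: ifP => // ik.
by rewrite (leq_trans ik kj).
Qed.
Lemma mix_upd (k : 'I_n) a x z : mix k x (upd k a z) = mix k.+1 (upd k a x) z.
Proof.
apply/ffunP => i; rewrite !ffunE ltnS (_ : (i == k) = (i == k :> nat)) //.
by case: ltngtP.
Qed.
Lemma mixS_upd (k : 'I_n) x z w :
  mix k.+1 (mix k x z) w = mix k.+1 (upd k (z k) x) w.
Proof.
apply/ffunP => i; rewrite !ffunE ltnS (_ : (i == k) = (i == k :> nat)) //.
by case: ltngtP => // /val_inj ->.
Qed.

Lemma Ex_mix k (phi : word -> R) :
  EX phi = EX (fun x => EX (fun z => phi (mix k x z))).
Proof.
transitivity (EX (fun x => EX (fun z : word => phi x))).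
  by apply: eq_Ex => x; rewrite Ex_cst.
(* Exchanging the suffixes of two independent uniform words is a measure-preserving involution. *)
pose h (p : word * word) := (mix k p.1 p.2, mix k p.2 p.1).
rewrite (@Ex_unif2_invol R _ _ word0 word0 h (fun x _ => phi x)) //.
by move=> [x z]; rewrite /h /=; congr (_, _); apply/ffunP => i;
   rewrite !ffunE; case: ltnP.
Qed.

Lemma Ex_upd (k : 'I_n) (phi : word -> R) :
  EX phi = EG (fun a => EX (fun z => phi (upd k a z))).
Proof.
transitivity (EG (fun _ => EX phi)); first by rewrite Ex_cst.
pose h (p : G * word) := (p.2 k, upd k p.1 p.2).
rewrite (@Ex_unif2_invol R _ _ g0 word0 h (fun _ => phi)) //.
move=> [a z]; rewrite /h /=; congr (_, _); first by rewrite ffunE eqxx.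
by apply/ffunP => i; rewrite !ffunE; case: eqP => // ->.
Qed.

Section Prefix.
Variables (M : finType) (f : word -> M).

(** The likelihood of message [m] given the first [k] coordinates of [x]. *)
Definition pfx k x m : R := EX (fun z => (f (mix k x z) == m)%:R).

Definition revealed (tau : R) k x : bool :=
  tau * pfx k x (f x) <= pfx k.+1 x (f x).

Lemma pfx_ge0 k x m : 0 <= pfx k x m.
Proof. by apply: Ex_ge0 => z _; rewrite ler0n. Qed.

Lemma pfx_gt0 k x : 0 < pfx k x (f x).
Proof.
by apply: (@Ex_gt0 _ _ _ _ x) => [z||]; rewrite ?ler0n ?unif_gt0 // mixxx eqxx ltr0n.
Qed.

Lemma Ex_msg k x (psi : M -> R) :
  EX (fun z => psi (f (mix k x z))) = \sum_m psi m * pfx k x m.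
Proof.
rewrite /pfx; under [RHS]eq_bigr do rewrite -ExZ.
rewrite -Ex_sum; apply: eq_Ex => z.
rewrite (bigD1 (f (mix k x z))) //= eqxx mulr1 big1 ?addr0 // => m.
by rewrite eq_sym => /negPf ->; rewrite mulr0.
Qed.

Lemma pfx_sum k x : \sum_m pfx k x m = 1.
Proof.
under eq_bigr => m do rewrite -[pfx k x m]mul1r.
by rewrite -(Ex_msg k x (fun=> 1)) Ex_cst.
Qed.

Lemma pfx_mix k j x z m : (k <= j)%N -> pfx k (mix j x z) m = pfx k x m.
Proof. by move=> kj; apply: eq_Ex => w; rewrite mix_mix. Qed.

Lemma pfxn x m : pfx n x m = (f x == m)%:R.
Proof. by rewrite -[RHS](Ex_cst (unif R word0)); apply: eq_Ex => z; rewrite mixn. Qed.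

Lemma Ex_pfx (k : 'I_n) x (psi : G -> M -> R) :
  EX (fun z => psi (z k) (f (mix k x z))) =
  EG (fun a => \sum_m psi a m * pfx k.+1 (upd k a x) m).
Proof.
rewrite (Ex_upd k); apply: eq_Ex => a.
under eq_Ex do rewrite ffunE eqxx mix_upd.
exact: Ex_msg.
Qed.

(** The martingale property of the likelihoods. *)
Lemma pfx_avg (k : 'I_n) x m : pfx k x m = EG (fun a => pfx k.+1 (upd k a x) m).
Proof.
rewrite {1}/pfx (Ex_pfx k x (fun _ m' => (m' == m)%:R)); apply: eq_Ex => a.
rewrite (bigD1 m) //= eqxx mul1r big1 ?addr0 // => m' /negPf ->.
by rewrite mul0r.
Qed.

Lemma revealed_mix tau (k : 'I_n) x z :
  revealed tau k (mix k x z) =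
  (tau * pfx k x (f (mix k x z)) <= pfx k.+1 (upd k (z k) x) (f (mix k x z)))%R.
Proof.
rewrite /revealed pfx_mix //; congr (_ <= _).
by apply: eq_Ex => w; rewrite mixS_upd.
Qed.

(** Given the first [k.+1] coordinates, message [m] occurs with probability [pfx k.+1 x m], which
    cancels the denominator; the remaining values [pfx k x m] sum to 1. Messages of likelihood 0
    contribute nothing, hence only an inequality. *)
Lemma pfx_ratio_le1 (k : nat) : EX (fun x => pfx k x (f x) / pfx k.+1 x (f x)) <= 1.
Proof.
rewrite (Ex_mix k.+1) -[leRHS](Ex_cst (unif R word0)); apply: le_Ex => x _.
under eq_Ex do rewrite !pfx_mix //.
apply: (@le_trans _ _ (\sum_m pfx k x m)); last by rewrite pfx_sum.
rewrite (Ex_msg k.+1 x (fun m => pfx k x m / pfx k.+1 x m)).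
apply: ler_sum => m _; have [->|p0] := eqVneq (pfx k.+1 x m) 0.
  by rewrite mulr0 pfx_ge0.
by rewrite divfK.
Qed.

(* The likelihood ratios [pfx k.+1 / pfx k] telescope to the inverse of the
   probability of the message, whose mean logarithm is at most ln #|M|; the
   inverse of each ratio has mean at most 1. *)
Lemma revealed_count : EX (fun x => \sum_(k < n) (revealed 16 k x)%:R) <= ln #|M|%:R.
Proof.
pose y k x := pfx k.+1 x (f x) / pfx k x (f x).
have y0 k x : 0 < y k x by rewrite divr_gt0 ?pfx_gt0.
have M0 : 0 < #|M|%:R :> R.
  by rewrite ltr0n; apply/card_gt0P; exists (f word0).
apply: (@le_trans _ _ (EX (fun x => - ln (pfx 0 x (f x)) +
    \sum_(k < n) ((y k x)^-1 - 1)))).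
  apply: le_Ex => x _.
  have -> : - ln (pfx 0 x (f x)) = \sum_(k < n) ln (y k x).
    rewrite /y; under eq_bigr do rewrite ln_div ?posrE ?pfx_gt0 //.
    rewrite -(big_mkord predT (fun k => ln (pfx k.+1 x (f x)) - ln (pfx k x (f x)))).
    by rewrite telescope_sumr // pfxn eqxx ln1 sub0r.
  rewrite -big_split /=; apply: ler_sum => k _.
  by have := ind_ge16_le (y0 k x); rewrite -addrA {1}/y ler_pdivlMr ?pfx_gt0.
rewrite ExD Ex_sum -[leRHS]addr0 lerD //; last first.
  apply: sumr_le0 => k _; rewrite ExB Ex_cst subr_le0.
  by under eq_Ex do rewrite invf_div; apply: pfx_ratio_le1.
(* The entropy bound: with p the probability of the message, -ln p <= ln |M| + 1 / (p |M|) - 1, and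
   1 / p has mean at most |M|. *)
apply: (@le_trans _ _ (EX (fun x => ln #|M|%:R + ((pfx 0 x (f x))^-1 / #|M|%:R - 1)))).
  apply: le_Ex => x _; have p0 := pfx_gt0 0 x.
  have := @ln_ge1BV R (#|M|%:R * pfx 0 x (f x)) ltac:(by rewrite mulr_gt0).
  rewrite lnM ?posrE // invfM [_^-1 * _]mulrC; lra.
rewrite ExD Ex_cst ExB Ex_cst ExZr gerDl subr_le0 ler_pdivrMr // mul1r.
have -> : EX (fun x => (pfx 0 x (f x))^-1) =
    EX (fun x => (pfx 0 word0 (f (mix 0 word0 x)))^-1).
  apply: eq_Ex => x; rewrite mix0; congr (_^-1); rewrite /pfx; apply: eq_Ex => z; rewrite !mix0.
rewrite (Ex_msg 0 word0 (fun m => (pfx 0 word0 m)^-1)).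
rewrite -[#|M|]sum1_card natr_sum; apply: ler_sum => m _.
by have [->|p0] := eqVneq (pfx 0 word0 m) 0; rewrite ?mulr0 ?ler01 ?mulVf.
Qed.

End Prefix.
End Words.

(** * Adaptive hybrid argument *)

Section Hybrid.
Variables (R : realType) (G : finType) (g0 : G) (n : nat).
Variables (s : G -> G -> R) (lam r : R) (flipA flipB : G -> G).
Hypotheses (lam0 : 0 <= lam) (r0 : 0 < r) (rE : r ^+ 2 = lam * 16).
Hypotheses (s_op : op_bounded s lam) (s_opT : op_bounded (fun a b => s b a) lam).
Hypothesis s_sign : forall a b, s a b = 1 \/ s a b = -1.
Hypotheses (flipAK : involutive flipA) (flipBK : involutive flipB).
Hypothesis s_flipA : forall a b, s (flipA a) b = - s a b.
Hypothesis s_flipB : forall a b, s a (flipB b) = - s a b.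

Local Notation word := {ffun 'I_n -> G}.
Local Notation EX := (Ex (unif R (word0 g0 n))).
Local Notation EG := (Ex (unif R g0)).
Local Notation bias := (2 * r / #|G|%:R).

Variable M : finType.

Lemma s_norm a b : `|s a b| <= 1.
Proof. by case: (s_sign a b) => ->; rewrite ?normrN normr1. Qed.

Lemma Ex_pfx2 (f g : word -> M) (k : 'I_n) x y (T : G -> M -> G -> M -> R) :
  EX (fun z => EX (fun z' => T (z k) (f (mix k x z)) (z' k) (g (mix k y z')))) =
  EG (fun a => EG (fun b => \sum_m \sum_m' T a m b m' *
    (pfx R g0 f k.+1 (upd k a x) m * pfx R g0 g k.+1 (upd k b y) m'))).
Proof.
under eq_Ex => z do rewrite (Ex_pfx g0 g k y (T (z k) (f (mix k x z)))).
rewrite (Ex_pfx g0 f k x (fun a m =>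
  EG (fun b => \sum_m' T a m b m' * pfx R g0 g k.+1 (upd k b y) m'))).
apply: eq_Ex => a; rewrite Ex_sum; apply: eq_bigr => m _.
rewrite -ExZr; apply: eq_Ex => b; rewrite mulr_suml.
by apply: eq_bigr => m' _; ring.
Qed.

(** With both prefixes fixed, the two messages are independent given the letters at [k]. So
    [rectangle_bias] applies to the likelihoods at [k.+1] with means those at [k], heavy meaning
    revealed; dividing by the number of letter pairs turns [2 * (N * r)] into [bias]. *)
Lemma step_bias (f g : word -> M) (c : M -> M -> R) (k : 'I_n) x y :
  (forall m m', `|c m m'| <= 1) ->
  `|EX (fun z => EX (fun z' =>
      s (z k) (z' k) * c (f (mix k x z)) (g (mix k y z'))))| <=
  EX (fun z => EX (fun z' => (revealed g0 f (16 : R) k (mix k x z) &&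
                              revealed g0 g (16 : R) k (mix k y z'))%:R)) + bias.
Proof.
move=> c1; pose F m a := pfx R g0 f k.+1 (upd k a x) m.
pose H m a := pfx R g0 g k.+1 (upd k a y) m.
rewrite (Ex_pfx2 f g k x y (fun a m b m' => s a b * c m m')).
under [in leRHS]eq_Ex => z do under eq_Ex => z' do rewrite !revealed_mix.
rewrite (Ex_pfx2 f g k x y (fun a m b m' =>
  ((16 * pfx R g0 f k x m <= F m a)%R && (16 * pfx R g0 g k y m' <= H m' b)%R)%:R)).
have N0 : 0 < #|G|%:R :> R by rewrite ltr0n; apply/card_gt0P; exists g0.
have tau0 : 0 <= 16 :> R by [].
have := @rectangle_bias R G lam 16 r lam0 tau0 r0 rE M M s c F H
  (pfx R g0 f k x) (pfx R g0 g k y) s_op s_opT s_norm c1.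
have pS f' x' m : \sum_a pfx R g0 f' k.+1 (upd k a x') m = #|G|%:R * pfx R g0 f' k x' m.
  by rewrite (pfx_avg R g0 f' k x' m) -Ex_unif_sum.
move=> /(_ (fun m a => pfx_ge0 _ _ _ _ _ _)) /(_ _ (fun m a => pfx_ge0 _ _ _ _ _ _)).
have p1 f' j x' : \sum_m pfx R g0 f' j x' m <= 1 by rewrite pfx_sum.
move=> /(_ (fun a => p1 _ _ _ _ _) (fun a => p1 _ _ _ _ _) (pS _ f x) (pS _ g y)).
move=> /(_ (fun m => pfx_ge0 _ _ _ _ _ _) (fun m => pfx_ge0 _ _ _ _ _ _)).
move=> /(_ (p1 _ _ _ _ _) (p1 _ _ _ _ _)).
rewrite !(Ex_unif_sum g0).
under eq_Ex => a do rewrite (Ex_unif_sum g0).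
under [in leRHS]eq_Ex => a do rewrite (Ex_unif_sum g0).
rewrite !ExZ mulrA normrM (ger0_norm (_ : 0 <= #|G|%:R * #|G|%:R)) ?mulr_ge0 // => h.
rewrite -(ler_pM2l (mulr_gt0 N0 N0)); move: h.
set A := `|_|; set B := Ex _ _; set A' := `|_|; set B' := Ex _ _.
have -> : A = A'.
  congr (`|_|); apply: eq_Ex => a; apply: eq_Ex => b; rewrite mulr_sumr.
  apply: eq_bigr => m _; rewrite mulr_sumr; apply: eq_bigr => m' _; by rewrite mulrA.
have -> : B = B'.
  apply: eq_Ex => a; apply: eq_Ex => b; apply: eq_bigr => m _.
  apply: eq_bigr => m' _; rewrite -mulnb natrM; rewrite /F /H; ring.
move=> h; apply: le_trans h _; rewrite le_eqVlt; apply/orP; left; apply/eqP.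
by field; rewrite gt_eqF.
Qed.

Variables (Om : finType) (d : dist R Om) (f g : Om -> word -> M).
Variable c : Om -> M -> M -> bool.

Definition accept x y : R := Ex d (fun w => (c w (f w x) (g w y))%:R).

(** Only the first [k] coordinates of [x] and [y] matter, so the decision to tilt at [k] precedes
    the choice of the letters there. *)
Definition coll_prob (k : 'I_n) x y : R :=
  Ex d (fun w => EX (fun z => EX (fun z' =>
    (revealed g0 (f w) (16 : R) k (mix k x z) &&
     revealed g0 (g w) (16 : R) k (mix k y z'))%:R))).

Definition reveal_prob (h : Om -> word -> M) (k : 'I_n) x : R :=
  Ex d (fun w => EX (fun z => (revealed g0 (h w) (16 : R) k (mix k x z))%:R)).

Variable theta : R.
Hypothesis theta0 : 0 <= theta.

Definition rare k x y : bool := coll_prob k x y < theta.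

(** For [sg] equal to 1 or -1 this is a density factor: at a rare coordinate 2 if the sign there is
    [sg] and 0 otherwise, elsewhere 1. *)
Definition tilt (sg : R) k x y : R :=
  1 + sg * (rare k x y)%:R * s (x k) (y k).

Definition weight (sg : R) (k : nat) x y : R :=
  \prod_(i < n | (i < k)%N) tilt sg i x y.

Lemma coll_prob_mix (i : 'I_n) (k : nat) x y z z' : (i <= k)%N ->
  coll_prob i (mix k x z) (mix k y z') = coll_prob i x y.
Proof.
move=> ik; apply: eq_Ex => w; apply: eq_Ex => u; apply: eq_Ex => u'.
by rewrite !mix_mix.
Qed.

Lemma weightS sg (k : 'I_n) x y :
  weight sg k.+1 x y = weight sg k x y * tilt sg k x y.
Proof.
rewrite /weight (bigD1 k) //= mulrC; congr (_ * _); apply: eq_bigl => i.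
by rewrite ltnS (_ : (i == k) = (i == k :> nat)) //; case: ltngtP.
Qed.

Lemma weight0 sg x y : weight sg 0 x y = 1.
Proof. by rewrite /weight big_pred0. Qed.

Lemma weight_mix sg k x y z z' :
  weight sg k (mix k x z) (mix k y z') = weight sg k x y.
Proof.
apply: eq_bigr => i ik; rewrite /tilt /rare coll_prob_mix 1?ltnW //.
by rewrite !ffunE ik.
Qed.

Lemma tilt_ge0 sg k x y : `|sg| = 1 -> 0 <= tilt sg k x y.
Proof.
move=> sg1; rewrite /tilt; have := ler_norm (- (sg * (rare k x y)%:R * s (x k) (y k))).
rewrite normrN !normrM sg1 mul1r normr_nat.
have := s_norm (x k) (y k); case: (rare k x y) => /=; lra.
Qed.

Lemma weight_ge0 sg k x y : `|sg| = 1 -> 0 <= weight sg k x y.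
Proof. by move=> sg1; apply: prodr_ge0 => i _; apply: tilt_ge0. Qed.

Definition flip_at (h : G -> G) (k : 'I_n) (x : word) := upd k (h (x k)) x.

Lemma flip_atK h k : involutive h -> involutive (flip_at h k).
Proof.
move=> hK x; apply/ffunP => i; rewrite /flip_at /upd !ffunE eqxx.
by case: eqP => // ->.
Qed.

Lemma mix_flip h (i k : 'I_n) x z : (i <= k)%N ->
  mix i (flip_at h k x) z = mix i x z.
Proof.
move=> ik; apply/ffunP => j; rewrite !ffunE; case: ifP => // ji.
by case: eqP => // jk; move: ji; rewrite jk ltnNge ik.
Qed.

Lemma weight_flipB sg (k : 'I_n) x y :
  weight sg k x (flip_at flipB k y) = weight sg k x y.
Proof.
apply: eq_bigr => i ik; rewrite /tilt; congr (1 + _ * _%:R * _).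
  by rewrite /rare; congr (_ < _); apply: eq_Ex => w; apply: eq_Ex => u;
     apply: eq_Ex => u'; rewrite mix_flip // ltnW.
by rewrite /flip_at !ffunE; case: eqP => // e; move: ik; rewrite e ltnn.
Qed.

Lemma weight_flipA sg (k : 'I_n) x y :
  weight sg k (flip_at flipA k x) y = weight sg k x y.
Proof.
apply: eq_bigr => i ik; rewrite /tilt; congr (1 + _ * _%:R * _).
  by rewrite /rare; congr (_ < _); apply: eq_Ex => w; apply: eq_Ex => u;
     apply: eq_Ex => u'; rewrite mix_flip // ltnW.
by rewrite /flip_at !ffunE; case: eqP => // e; move: ik; rewrite e ltnn.
Qed.

Lemma tilt_flipB sg k x y :
  tilt sg k x (flip_at flipB k y) = 1 - (tilt sg k x y - 1).
Proof.
rewrite /tilt /flip_at !ffunE eqxx s_flipB.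
have -> : rare k x (upd k (flipB (y k)) y) = rare k x y; last by ring.
by rewrite /rare; congr (_ < _); apply: eq_Ex => w; apply: eq_Ex => u;
     apply: eq_Ex => u'; rewrite (mix_flip flipB).
Qed.

Lemma tilt_flipA sg k x y :
  tilt sg k (flip_at flipA k x) y = 1 - (tilt sg k x y - 1).
Proof.
rewrite /tilt /flip_at !ffunE eqxx s_flipA.
have -> : rare k (upd k (flipA (x k)) x) y = rare k x y; last by ring.
by rewrite /rare; congr (_ < _); apply: eq_Ex => w; apply: eq_Ex => u;
     apply: eq_Ex => u'; rewrite (mix_flip flipA).
Qed.

Lemma Ex_half (T : finType) (t0 : T) (h : T -> T) (phi : T -> R) c0 :
  involutive h -> (forall t, phi (h t) = c0 - phi t) ->
  Ex (unif R t0) phi = c0 / 2.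
Proof.
move=> hK e; have := Ex_unif_invol t0 phi hK.
rewrite (eq_Ex _ (e : phi \o h =1 _)) ExB Ex_cst; lra.
Qed.

(** Flipping Bob's letter at the last coordinate reflects its tilt about 1 and keeps the earlier
    factors. Hence each player's own input stays uniform under [weight], although the pair is
    correlated. *)
Lemma marginalA sg k x : (k <= n)%N -> EX (fun y => weight sg k x y) = 1.
Proof.
elim: k => [|k IH] kn.
  by under eq_Ex do rewrite weight0; rewrite Ex_cst.
under eq_Ex do rewrite (weightS _ (Ordinal kn)).
rewrite -[RHS](IH (ltnW kn)); apply/eqP; rewrite -subr_eq0 -ExB; apply/eqP.
rewrite (@Ex_half _ (word0 g0 n) (flip_at flipB (Ordinal kn)) _ 0) ?mul0r //.
  exact: flip_atK.
move=> y; rewrite tilt_flipB (weight_flipB sg (Ordinal kn)) /=; ring.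
Qed.

Lemma marginalB sg k y : (k <= n)%N -> EX (fun x => weight sg k x y) = 1.
Proof.
elim: k => [|k IH] kn.
  by under eq_Ex do rewrite weight0; rewrite Ex_cst.
under eq_Ex do rewrite (weightS _ (Ordinal kn)).
rewrite -[RHS](IH (ltnW kn)); apply/eqP; rewrite -subr_eq0 -ExB; apply/eqP.
rewrite (@Ex_half _ (word0 g0 n) (flip_at flipA (Ordinal kn)) _ 0) ?mul0r //.
  exact: flip_atK.
move=> x; rewrite tilt_flipA (weight_flipA sg (Ordinal kn)) /=; ring.
Qed.

Local Notation EXY := (fun phi => EX (fun x => EX (fun y => phi x y))).

(** Given the prefixes, the two hybrids differ by the correlation of acceptance with the sign at
    [k], and only if [k] is rare. Then [step_bias] bounds it by [coll_prob] plus [bias], and rarity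
    puts [coll_prob] below [theta]. *)
Lemma hybrid_step sg (k : 'I_n) : `|sg| = 1 ->
  `|EXY (fun x y => weight sg k.+1 x y * accept x y) -
    EXY (fun x y => weight sg k x y * accept x y)| <= theta + bias.
Proof.
move=> sg1; rewrite -ExB; under eq_Ex do rewrite -ExB.
pose t x y : R := (rare k x y)%:R.
pose inner x y := EX (fun z => EX (fun z' =>
  s (z k) (z' k) * accept (mix k x z) (mix k y z'))).
have -> : EXY (fun x y => weight sg k.+1 x y * accept x y -
      weight sg k x y * accept x y) =
    EXY (fun x y => weight sg k x y * (sg * t x y * inner x y)).
  rewrite (Ex_mix g0 k); apply: eq_Ex => x.
  rewrite Ex_exchange (Ex_mix g0 k); apply: eq_Ex => y.
  rewrite Ex_exchange /inner mulrA -ExZ; apply: eq_Ex => z.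
  rewrite -ExZ; apply: eq_Ex => z'.
  rewrite weightS weight_mix /tilt /rare coll_prob_mix //.
  rewrite -/(rare k x y) -/(t x y) !ffunE ltnn; ring.
have bias0 : 0 <= bias by rewrite divr_ge0 // mulr_ge0 // ltW.
have inner_le x y : `|inner x y| <= coll_prob k x y + bias.
  rewrite /inner /accept.
  under eq_Ex => z do under eq_Ex => z' do rewrite -ExZ.
  under eq_Ex => z do rewrite Ex_exchange.
  rewrite Ex_exchange; apply: le_trans (normr_Ex _ _) _.
  rewrite -[bias](Ex_cst d) -ExD; apply: le_Ex => w _.
  apply: (@step_bias (f w) (g w) (fun m m' => (c w m m')%:R) k x y) => m m'.
  by rewrite normr_nat lern1 leq_b1.
apply: le_trans (normr_Ex _ _) _; rewrite -[leRHS](Ex_cst (unif R (word0 g0 n))).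
apply: le_Ex => x _; apply: le_trans (normr_Ex _ _) _.
apply: (@le_trans _ _ (EX (fun y => weight sg k x y * (theta + bias)))); last first.
  by rewrite ExZr marginalA ?mul1r // ltnW.
apply: le_Ex => y _; rewrite normrM (ger0_norm (weight_ge0 _ _ _ sg1)).
rewrite ler_wpM2l ?weight_ge0 // !normrM sg1 mul1r normr_nat /t.
case: (boolP (rare k x y)) => [rk|_] /=; last by rewrite mul0r addr_ge0.
rewrite mul1r; apply: le_trans (inner_le x y) _; rewrite lerD2r; exact: ltW.
Qed.

Lemma hybrid_total sg : `|sg| = 1 ->
  `|EXY (fun x y => weight sg n x y * accept x y) - EXY accept| <=
  n%:R * (theta + bias).
Proof.
move=> sg1; suff: forall k, (k <= n)%N ->
    `|EXY (fun x y => weight sg k x y * accept x y) - EXY accept| <=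
    k%:R * (theta + bias) by apply.
elim=> [|k IH] kn.
  rewrite mul0r normr_le0 subr_eq0; apply/eqP; apply: eq_Ex => x.
  by apply: eq_Ex => y; rewrite weight0 mul1r.
have := hybrid_step (Ordinal kn) sg1; have := IH (ltnW kn) => /=.
set A := EX _; set B := EX _; set C := EX _ => h1 h2.
have -> : C - B = (A - B) + (C - A) by ring.
by rewrite -natr1 mulrDl mul1r; apply: le_trans (ler_normD _ _) (lerD _ _).
Qed.

Hypothesis accept_hi : forall x y : word,
  (2 * n <= 3 * #|[set i : 'I_n | (s (x i) (y i) == -1)%R]|)%N -> 2 / 3 <= accept x y.
Hypothesis accept_lo : forall x y : word,
  (2 * n <= 3 * #|[set i : 'I_n | (s (x i) (y i) == 1)%R]|)%N -> accept x y <= 1 / 3.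
Hypothesis small : 2 * (n%:R * (theta + bias)) < 6^-1.

Definition many x y : bool := (n < 3 * #|[set k | ~~ rare k x y]|)%N.

(** A nonzero weight forces sign [sg] at every rare coordinate, as a wrong sign makes a factor
    vanish. *)
Lemma rare_sign (sg : R) x y : sg = 1 \/ sg = -1 -> weight sg n x y != 0 ->
  ~~ many x y -> (2 * n <= 3 * #|[set i : 'I_n | (s (x i) (y i) == sg)%R]|)%N.
Proof.
move=> sgE w0; rewrite /many -leqNgt => few.
have sub : [set i | rare i x y] \subset [set i : 'I_n | (s (x i) (y i) == sg)%R].
  apply/fintype.subsetP => i; rewrite !inE => ri.
  move: w0; rewrite prodf_seq_neq0 => /allP/(_ i (mem_index_enum i)).
  rewrite ltn_ord /= /tilt ri mulr1.
  case: (s_sign (x i) (y i)) => ->; case: sgE => ->; rewrite ?mulr1 ?mul1r ?mulN1r ?opprK ?eqxx //.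
    by rewrite subrr eqxx.
  by rewrite subrr eqxx.
have := subset_leq_card sub.
have := cardsC [set i | rare i x y]; rewrite card_ord.
have -> : ~: [set i | rare i x y] = [set k | ~~ rare k x y].
  by apply/finset.setP => i; rewrite !inE.
lia.
Qed.

(** Otherwise acceptance is at most 1/3 + 1/12 for sign 1 and at least 2/3 - 1/18 for sign -1. This
    gap of 7/36 exceeds 1/6, yet both values are close to the one for uniform inputs. *)
Lemma exists_many : exists2 sg : R, `|sg| = 1 &
  12^-1 < EXY (fun x y => weight sg n x y * (many x y)%:R).
Proof.
apply: contrapT => no.
have le12 (sg : R) : `|sg| = 1 -> EXY (fun x y => weight sg n x y * (many x y)%:R) <= 12^-1.
  by move=> sg1; rewrite leNgt; apply/negP => h; apply: no; exists sg.
have n1 : `|1 : R| = 1 by rewrite normr1.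
have nN1 : `|-1 : R| = 1 by rewrite normrN normr1.
have lo := le12 _ n1; have hi := le12 _ nN1.
have tot sg : EXY (fun x y => weight sg n x y) = 1.
  by under eq_Ex do rewrite marginalA //; rewrite Ex_cst.
have accept01 x y : 0 <= accept x y <= 1.
  rewrite Ex_ge0 //= -[leRHS](Ex_cst d); apply: le_Ex => w _.
  by rewrite lern1 leq_b1.
have up : EXY (fun x y => weight 1 n x y * accept x y) <= 1 / 3 + 12^-1.
  apply: (@le_trans _ _ (EXY (fun x y => weight 1 n x y * (1 / 3) +
      weight 1 n x y * (many x y)%:R))); last first.
    under eq_Ex do rewrite ExD ExZr.
    by rewrite ExD ExZr tot mul1r lerD2l.
  apply: le_Ex => x _; apply: le_Ex => y _; rewrite -mulrDr.
  have [->|w0] := eqVneq (weight 1 n x y) 0; first by rewrite !mul0r.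
  rewrite ler_wpM2l ?weight_ge0 //.
  have /andP[_ a1] := accept01 x y; case: (boolP (many x y)) => [_|fw] /=; first by lra.
  rewrite addr0; apply: accept_lo; apply: rare_sign => //; by left.
have dn : 2 / 3 - 2 / 3 * 12^-1 <= EXY (fun x y => weight (-1) n x y * accept x y).
  apply: (@le_trans _ _ (EXY (fun x y => weight (-1) n x y * (2 / 3) -
      (2 / 3) * (weight (-1) n x y * (many x y)%:R)))).
    under eq_Ex do rewrite ExB ExZr ExZ.
    by rewrite ExB ExZr ExZ tot mul1r; lra.
  apply: le_Ex => x _; apply: le_Ex => y _; rewrite [2 / 3 * (_ * _)]mulrCA -mulrBr.
  have [->|w0] := eqVneq (weight (-1) n x y) 0; first by rewrite !mul0r.
  rewrite ler_wpM2l ?weight_ge0 //.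
  have /andP[a0 _] := accept01 x y; case: (boolP (many x y)) => [_|fw].
    by rewrite mulr1 subrr.
  rewrite mulr0 subr0; apply: accept_hi; apply: rare_sign => //; by right.
have := hybrid_total n1; have := hybrid_total nN1.
rewrite !ler_norml => /andP[_ h1] /andP[h2 _].
move: up dn h1 h2 small; lra.
Qed.

Lemma Ex_reveal_sum (h : Om -> word -> M) :
  EX (fun x => \sum_k reveal_prob h k x) <= ln #|M|%:R.
Proof.
have -> : EX (fun x => \sum_k reveal_prob h k x) =
    Ex d (fun w => EX (fun x => \sum_(k < n) (revealed g0 (h w) (16 : R) k x)%:R)).
  rewrite Ex_sum; under [RHS]eq_Ex do rewrite Ex_sum.
  rewrite [RHS]Ex_sum; apply: eq_bigr => k _; rewrite /reveal_prob [LHS]Ex_exchange.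
  by apply: eq_Ex => w; rewrite [RHS](Ex_mix g0 k).
rewrite -[leRHS](Ex_cst d); apply: le_Ex => w _; exact: revealed_count.
Qed.

(** Under the tilted distribution both revelation counts keep their uniform means, together at most
    [2 * L]. By Markov they reach [48 * L] with probability at most 1/24, less than the 1/12
    guaranteed for [many]. *)
Lemma good_prefix (L : R) : 0 < L -> ln #|M|%:R <= L ->
  exists x y : word, (n < 3 * #|[set k | (theta <= coll_prob k x y)%R]|)%N /\
    \sum_k reveal_prob f k x + \sum_k reveal_prob g k y < 48 * L.
Proof.
move=> L0 leL; have [sg sg1 hi] := exists_many.
pose a x := \sum_k reveal_prob f k x; pose b y := \sum_k reveal_prob g k y.
have Ea : EXY (fun x y => weight sg n x y * a x) <= L.
  under eq_Ex do rewrite ExZr marginalA // mul1r.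
  exact: le_trans (Ex_reveal_sum f) leL.
have Eb : EXY (fun x y => weight sg n x y * b y) <= L.
  rewrite Ex_exchange; under eq_Ex do rewrite ExZr marginalB // mul1r.
  exact: le_trans (Ex_reveal_sum g) leL.
have : 0 < EXY (fun x y => weight sg n x y * ((many x y)%:R - (a x + b y) / (48 * L))).
  have -> : EXY (fun x y => weight sg n x y * ((many x y)%:R - (a x + b y) / (48 * L))) =
     EXY (fun x y => weight sg n x y * (many x y)%:R) -
     (EXY (fun x y => weight sg n x y * a x) + EXY (fun x y => weight sg n x y * b y)) /
       (48 * L).
    rewrite -ExD -ExZr -ExB; apply: eq_Ex => x.
    rewrite -ExD -ExZr -ExB; apply: eq_Ex => y; ring.
  rewrite subr_gt0; apply: le_lt_trans hi.
  rewrite ler_pdivrMr ?mulr_gt0 //; lra.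
move=> /Ex_gt_witness[x _] /Ex_gt_witness[y _] pos.
exists x, y; have w0 := weight_ge0 n x y sg1.
have a0 : 0 <= a x + b y.
  by rewrite addr_ge0 // sumr_ge0 // => k _; do 2![apply: Ex_ge0 => ? _]; rewrite ler0n.
have {}pos : (a x + b y) / (48 * L) < (many x y)%:R.
  rewrite ltNge; apply/negP => neg; move: pos.
  by rewrite ltNge mulr_ge0_le0 // subr_le0.
have q0 : 0 <= (a x + b y) / (48 * L) by rewrite divr_ge0 // mulr_ge0 // ltW.
move: pos; case: (boolP (many x y)) => [mn|_] /=; last by rewrite ltNge q0.
rewrite ltr_pdivrMr ?mulr_gt0 // mul1r; split=> //.
move: mn; rewrite /many; congr (_ < 3 * #|pred_of_set _|)%N.
by apply/finset.setP => k; rewrite !inE /rare -leNgt.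
Qed.

End Hybrid.

(** * The inner product as a balanced sign matrix *)

Section Signs.
Variables (R : realType) (m : nat).
Local Notation G := 'rV['F_2]_m.
Implicit Types (a b x y : G).

Definition sgn2 (e : 'F_2) : R := if e == 0 then 1 else -1.

Lemma F2_cases (e : 'F_2) : e = 0 \/ e = 1.
Proof. by case: e => -[|[|//]] lt; [left|right]; apply: val_inj. Qed.

Lemma sgn2D (e e' : 'F_2) : sgn2 (e + e') = sgn2 e * sgn2 e'.
Proof.
by case: (F2_cases e) => ->; case: (F2_cases e') => ->;
   rewrite /sgn2 /= ?mulr1 ?mul1r // mulrNN mulr1.
Qed.

Lemma sgn2_sign e : sgn2 e = 1 \/ sgn2 e = -1.
Proof. by rewrite /sgn2; case: ifP; [left|right]. Qed.

Lemma N1_neq1 : ((-1 : R) == 1) = false.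
Proof. by apply/negP => /eqP e; have : (0 : R) < 1 := ltr01; lra. Qed.

Lemma sgn2_eq1 e : (sgn2 e == 1) = (e == 0).
Proof. by rewrite /sgn2; case: ifP; rewrite ?eqxx ?N1_neq1. Qed.

Lemma sgn2_eqN1 e : (sgn2 e == -1) = (e == 1).
Proof.
case: (F2_cases e) => ->; rewrite /sgn2 /= ?eqxx //.
by rewrite eq_sym N1_neq1.
Qed.

Lemma dot2C a b : dot2 a b = dot2 b a.
Proof. by apply: eq_bigr => j _; rewrite mulrC. Qed.

Lemma dot2_delta j a b : dot2 (a + delta_mx 0 j) b = dot2 a b + b 0 j.
Proof.
rewrite /dot2; under eq_bigr do rewrite !mxE mulrDl.
rewrite big_split; congr (_ + _); rewrite (bigD1 j) //= !eqxx mul1r.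
by rewrite big1 ?addr0 // => i /negPf ->; rewrite ?andbF mul0r.
Qed.

(* Alice's vectors have a 1 at [i1] and Bob's at [i0], so that flipping the
   free coordinate [i0] of [x], or [i1] of [y], flips the inner product: all
   rows and columns of [sign_ip] sum to zero. *)
Definition set1 (i : 'I_m) x : G := \row_j (if j == i then 1 else x 0 j).

Definition sign_ip (i0 i1 : 'I_m) x y : R := sgn2 (dot2 (set1 i1 x) (set1 i0 y)).

Definition flip (j : 'I_m) x : G := x + delta_mx 0 j.

Lemma flipK j : involutive (flip j).
Proof.
move=> x; rewrite /flip -addrA -[RHS]addr0; congr (_ + _).
apply/rowP => i; rewrite !mxE; by case: (_ && _); apply: val_inj.
Qed.

Lemma set1_flip i j x : j != i -> set1 i (flip j x) = set1 i x + delta_mx 0 j.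
Proof.
move=> ji; apply/rowP => k; rewrite !mxE; case: (k =P i) => // ->.
by rewrite eqxx eq_sym (negPf ji) addr0.
Qed.

Lemma sign_ip_flipA i0 i1 j x y : j != i1 ->
  sign_ip i0 i1 (flip j x) y = sign_ip i0 i1 x y * sgn2 (set1 i0 y 0 j).
Proof. by move=> ji; rewrite /sign_ip set1_flip // dot2_delta sgn2D. Qed.

Lemma sign_ipC i0 i1 x y : sign_ip i0 i1 x y = sign_ip i1 i0 y x.
Proof. by rewrite /sign_ip dot2C. Qed.

Lemma sign_ip_flipB i0 i1 j x y : j != i0 ->
  sign_ip i0 i1 x (flip j y) = sign_ip i0 i1 x y * sgn2 (set1 i1 x 0 j).
Proof. by move=> ji; rewrite sign_ipC sign_ip_flipA // sign_ipC. Qed.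

Lemma sgn2_set1 i x : sgn2 (set1 i x 0 i) = -1.
Proof. by rewrite mxE eqxx. Qed.

Definition same_off (i0 i1 : 'I_m) a b : bool :=
  [forall j, (j != i0) ==> (j != i1) ==> (a 0 j == b 0 j)].

Lemma card_same_off i0 i1 a : (#|[set b : G | same_off i0 i1 a b]| <= 4)%N.
Proof.
pose h b : 'F_2 * 'F_2 := (b 0 i0, b 0 i1).
have -> : 4%N = #|{: 'F_2 * 'F_2}| by rewrite card_prod card_Fp.
rewrite -(@card_in_imset _ _ h) ?max_card // => b b'.
rewrite !inE => /forallP ab /forallP ab' [e0 e1]; apply/rowP => j.
have [->//|n0] := eqVneq j i0; have [->//|n1] := eqVneq j i1.
by move: (ab j) (ab' j); rewrite n0 n1 /= => /eqP <- /eqP <-.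
Qed.

(** Flipping [y] at a free position where [a] and [b] differ changes the sign of exactly one
    factor. *)
Lemma sign_ip_orth i0 i1 a b : ~~ same_off i0 i1 a b ->
  \sum_y sign_ip i0 i1 a y * sign_ip i0 i1 b y = 0.
Proof.
rewrite negb_forall => /existsP[j]; rewrite !negb_imply => /and3P[j0 j1 ab].
set S := \sum_y _; suff : S = - S by lra.
rewrite {1}/S (reindex_inj (can_inj (flipK j))) /= -sumrN.
apply: eq_bigr => y _; rewrite !sign_ip_flipB // !mxE (negPf j1).
have -> : sgn2 (b 0 j) = - sgn2 (a 0 j).
  move: ab; case: (F2_cases (a 0 j)) => ->; case: (F2_cases (b 0 j)) => ->;
  by rewrite ?eqxx // /sgn2 /= ?opprK.
have : sgn2 (a 0 j) ^+ 2 = 1 by case: (sgn2_sign (a 0 j)) => ->; rewrite ?sqrrN expr1n.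
move: (sgn2 _) (sign_ip _ _ _ _) (sign_ip _ _ _ _) => e p q e2.
by transitivity (- (q * p) * e ^+ 2); [ring | rewrite e2 mulr1].
Qed.

(** Schur's test on the Gram matrix [K] of the rows: by orthogonality each of its rows has at most 4
    nonzero entries, each of size at most [#|G|]. *)
Lemma sign_ip_op i0 i1 : op_bounded (sign_ip i0 i1) (4 * #|G|%:R).
Proof.
move=> h; pose K a b : R := \sum_y sign_ip i0 i1 a y * sign_ip i0 i1 b y.
have -> : \sum_y (\sum_a h a * sign_ip i0 i1 a y) ^+ 2 =
    \sum_a \sum_b h a * h b * K a b.
  under eq_bigr => y _ do rewrite expr2 big_distrlr /=.
  rewrite exchange_big; apply: eq_bigr => a _ /=.
  rewrite exchange_big; apply: eq_bigr => b _ /=.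
  by rewrite mulr_sumr; apply: eq_bigr => y _; ring.
have K_le a b : `|K a b| <= (same_off i0 i1 a b)%:R * #|G|%:R.
  case: (boolP (same_off i0 i1 a b)) => [_|/sign_ip_orth]; last first.
    by rewrite /K => ->; rewrite normr0 mul0r.
  rewrite mul1r; apply: le_trans (ler_norm_sum _ _ _) _.
  rewrite -[#|G|]sum1_card natr_sum; apply: ler_sum => y _; rewrite normrM.
  by case: (sgn2_sign (dot2 (set1 i1 a) (set1 i0 y)));
     case: (sgn2_sign (dot2 (set1 i1 b) (set1 i0 y)));
     rewrite /sign_ip => -> ->; rewrite ?normrN !normr1 mulr1.
pose T a b : R := (same_off i0 i1 a b)%:R * #|G|%:R.
have symT a b : T a b = T b a.
  rewrite /T /same_off; congr (_%:R * _); congr nat_of_bool.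
  by apply: eq_forallb => j; rewrite [a 0 j == _]eq_sym.
have T0 a b : 0 <= T a b by rewrite mulr_ge0.
have rowT a : \sum_b T a b <= 4 * #|G|%:R.
  rewrite /T -mulr_suml ler_wpM2r // -natr_sum.
  rewrite -(_ : #|[set b | same_off i0 i1 a b]| = (\sum_b same_off i0 i1 a b)%N).
    by rewrite ler_nat card_same_off.
  rewrite -sum1_card big_mkcond; apply: eq_bigr => b _.
  by rewrite inE; case: same_off.
apply: (@le_trans _ _ (\sum_a \sum_b (h a ^+ 2 * T a b + h b ^+ 2 * T b a) / 2)).
  apply: ler_sum => a _; apply: ler_sum => b _; rewrite (symT b a) -mulrDl.
  apply: le_trans (ler_norm _) _; rewrite normrM.
  apply: le_trans (ler_wpM2l (normr_ge0 _) (K_le a b)) _; rewrite -/(T a b).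
  rewrite mulrAC ler_wpM2r // normrM.
  have := sqr_ge0 (`|h a| - `|h b|); rewrite sqrrB !real_normK ?num_real //; lra.
under eq_bigr do rewrite -mulr_suml big_split /=.
rewrite -mulr_suml big_split /= [X in _ + X]exchange_big /= -mulr2n -[X in X / 2]mulr_natr mulfK //.
rewrite mulr_sumr; apply: ler_sum => a _.
by rewrite -mulr_sumr [leRHS]mulrC ler_wpM2l ?sqr_ge0.
Qed.

End Signs.

(** * Bounded messages and numerical estimates *)

Lemma card_bseq_bool c : (#|{: c.-bseq bool}| <= 2 ^ c.+1)%N.
Proof.
rewrite card_bseq card_bool; elim: c => [|c IH]; first by rewrite big_ord1.
by rewrite big_ord_recr /= [in leqRHS]expnS mul2n -addnn leq_add2r.
Qed.

Lemma val_insub_bseq (T : Type) c (s : seq T) :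
  (size s <= c)%N -> insub_bseq c s = s :> seq T.
Proof. by move=> sc; rewrite /insub_bseq /insubd; case: insubP => [u _ /= ->|]; rewrite ?sc. Qed.

Lemma leq_mod_sum (R : realType) (n q : nat) (F : nat -> R) :
  (forall j, 0 <= F j) -> (n <= 3 * q)%N ->
  \sum_(i < n) F (i %% q)%N <= 3 * \sum_(j < q) F j.
Proof.
move=> F0 nq; rewrite -(big_mkord predT (fun i => F (i %% q)%N)).
apply: (@le_trans _ _ (\sum_(0 <= i < 3 * q) F (i %% q)%N)).
  rewrite (big_cat_nat (leq0n n) nq) /= lerDl; exact: sumr_ge0.
have -> : (3 * q = q + (q + q))%N by lia.
rewrite big_mkord !big_split_ord /=.
have e1 : \sum_(i < q) F (i %% q)%N = \sum_(j < q) F j.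
  by apply: eq_bigr => i _; rewrite modn_small.
have e2 : \sum_(i < q) F ((q + i) %% q)%N = \sum_(j < q) F j.
  by apply: eq_bigr => i _; rewrite modnDl modn_small.
have e3 : \sum_(i < q) F ((q + (q + i)) %% q)%N = \sum_(j < q) F j.
  by apply: eq_bigr => i _; rewrite !modnDl modn_small.
by rewrite e1 e2 e3; lra.
Qed.

(** Cycling through [S] uses each of its elements at most three times. This gives every element of
    the collision domain a coordinate to test. *)
Lemma few_to_one (R : realType) (n : nat) (S : {set 'I_n}) :
  (n < 3 * #|S|)%N -> exists phi : 'I_n -> 'I_n,
    (forall i, phi i \in S) /\
    (forall F : 'I_n -> R, (forall i, 0 <= F i) ->
       \sum_i F (phi i) <= 3 * \sum_i F i).
Proof.
move=> nS; have S0 : (0 < #|S|)%N by lia.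
have /card_gt0P[k0 _] := S0.
exists (fun i : 'I_n => nth k0 (enum S) (i %% #|S|)); split=> [i|F F0].
  by rewrite -mem_enum mem_nth // -cardE ltn_pmod.
pose F' j := F (nth k0 (enum S) j).
apply: (le_trans (@leq_mod_sum R n #|S| F' (fun _ => F0 _) (ltnW nS))).
rewrite ler_pM2l ?ltr0n //.
apply: (@le_trans _ _ (\sum_(i in S) F i)); last first.
  by rewrite [leRHS](bigID (mem S)) /= lerDl sumr_ge0.
rewrite -[leRHS]big_enum (big_nth k0) -cardE big_mkord; exact: lexx.
Qed.

Lemma expr_1sub_le (R : realType) (p : R) (k : nat) : 0 <= p <= 1 ->
  (1 - p) ^+ k * (1 + p * k%:R) <= 1.
Proof.
move=> /andP[p0 p1]; elim: k => [|k IH]; first by rewrite expr0 mulr0 addr0 mulr1.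
rewrite exprS -natr1; apply: le_trans IH; rewrite -mulrA mulrCA.
rewrite ler_wpM2l ?exprn_ge0 ?subr_ge0 //.
have : 0 <= p * p * k%:R by rewrite !mulr_ge0.
have : 0 <= p * p by rewrite mulr_ge0.
lra.
Qed.

(** 96 runs at success probability 1 / (48 n) fail together with probability at most 1 / (1 + 2 /
    n), and 2 / (n + 2) >= 1 / n. *)
Lemma amplified_ge (R : realType) (n : nat) : (2 <= n)%N ->
  (n%:R : R)^-1 <= 1 - (1 - ((24 * n)%:R)^-1 / 2) ^+ 96.
Proof.
move=> n2; have n2R : (2 : R) <= n%:R by rewrite ler_nat.
have n0 : 0 < n%:R :> R by lra.
set v : R := n%:R^-1; have v0 : 0 < v by rewrite invr_gt0.
have v2 : v <= 2^-1 by rewrite lef_pV2 ?posrE.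
set p : R := _ / 2; have pE : p = v / 48.
  by rewrite /p /v natrM invfM; field; rewrite gt_eqF.
have := @expr_1sub_le R p 96 ltac:(lra).
rewrite pE; move: (_ ^+ 96) => A h.
rewrite lerBrDr -lerBrDl -(@ler_pM2r _ (1 + v / 48 * 96)); last by lra.
apply: le_trans h _; nra.
Qed.

Lemma msg_size_le (R : realType) (U V X Y : finType) (Z : eqType)
    (rho : dist R (U * V)%type) (P : smp_protocol R U V X Y Z) x y w :
  0 < smp_dist rho P w ->
  (size (msgA x w) + size (msgB y w) <= smp_cost rho P)%N.
Proof.
move=> w0; rewrite /smp_cost.
apply: leq_trans (leq_bigmax x); apply: leq_trans (leq_bigmax y).
exact: (@leq_bigmax_cond (smp_space P) (fun v => 0 < smp_dist rho P v)
  (fun v => size (msgA x v) + size (msgB y v))%N w w0).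
Qed.

(** * From protocols for GAPIP to collisions *)

(** The bound of [good_prefix] with [L = 2 * c], times the multiplicity 3 from [few_to_one]. *)
Lemma reveal_budget (R : realType) (A B c : R) :
  0 <= B -> A + B < 48 * (2 * c) -> 3 * A <= 288 * c.
Proof. lra. Qed.

Lemma cap_budget (R : realType) (c : R) : 1 <= c -> 4 * (1 + 288 * c) <= 1156 * c.
Proof. lra. Qed.

Section CollisionFromSmp.
Variables (R : realType) (U V : finType) (rho : dist R (U * V)%type) (n : nat).
Hypothesis n2 : (2 <= n)%N.
Local Notation m := (8 * trunc_log 2 n)%N.
Local Notation G := 'rV['F_2]_m.
Local Notation input := {ffun 'I_n -> G}.
Variable P : smp_protocol R U V input input bool.
Variable delta : R.
Hypothesis delta_lt : delta < 3^-1.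
Hypothesis errP : has_error rho P (@GAPIP n) delta.

Lemma m_gt1 : (1 < m)%N.
Proof.
have : (1 <= trunc_log 2 n)%N by apply: trunc_log_max.
lia.
Qed.

Lemma count_dot_le (x y : input) : (count_dot x y 0%R + count_dot x y 1%R <= n)%N.
Proof.
rewrite /count_dot -cardsUI.
rewrite (_ : _ :&: _ = finset.set0) ?cards0 ?addn0; last first.
  apply/finset.setP => i; rewrite !inE; apply/negP => /andP[/eqP ->].
  by [].
by apply: leq_trans (max_card _) _; rewrite card_ord.
Qed.

Lemma GAPIP_false (x y : input) :
  (2 * n <= 3 * count_dot x y 0%R)%N -> GAPIP x y = Some false.
Proof. by rewrite /GAPIP /gapip => ->. Qed.

Lemma GAPIP_true (x y : input) :
  (2 * n <= 3 * count_dot x y 1%R)%N -> GAPIP x y = Some true.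
Proof.
move=> h; rewrite /GAPIP /gapip h; have := count_dot_le x y.
by case: ifP => //; lia.
Qed.

Lemma count_dot_all (x y : input) e :
  (forall i, dot2 (x i) (y i) = e) -> count_dot x y e = n.
Proof.
by move=> h; rewrite -[RHS]card_ord; apply: eq_card => i; rewrite !inE h eqxx.
Qed.

Lemma Pr_answer_true_false x y :
  Pr (smp_dist rho P) (fun w => answer x y w == false) =
  1 - Pr (smp_dist rho P) (fun w => answer x y w == true).
Proof.
rewrite !PrE -[X in X - _](Ex_cst (smp_dist rho P)) -ExB; apply: eq_Ex => w.
by case: (answer x y w); rewrite /= ?subr0 ?subrr.
Qed.

(** With empty messages the answer has the same distribution on all inputs, but both answers do
    occur. Positivity lets the cost absorb additive constants. *)
Lemma GAPIP_cost_gt0 : (0 < smp_cost rho P)%N.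
Proof.
rewrite lt0n; apply/eqP => c0.
have nil x y w : 0 < smp_dist rho P w -> msgA x w = [::] /\ msgB y w = [::].
  move=> /(msg_size_le x y); rewrite c0 leqn0 addn_eq0.
  by rewrite !size_eq0 => /andP[/eqP -> /eqP ->].
pose x0 : input := [ffun=> 0].
pose j0 : 'I_m := Ordinal (ltnW m_gt1).
pose x1 : input := [ffun=> delta_mx 0 j0].
have d0 i : dot2 (x0 i) (x0 i) = 0.
  by rewrite /dot2 big1 // => j _; rewrite !ffunE !mxE mul0r.
have d1 i : dot2 (x1 i) (x1 i) = 1.
  rewrite /dot2 (bigD1 j0) //= big1 ?addr0 => [|j /negPf ji].
    by rewrite !ffunE !mxE !eqxx mulr1.
  by rewrite !ffunE !mxE ji andbF mul0r.
have e0 : GAPIP x0 x0 = Some false.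
  by apply: GAPIP_false; rewrite count_dot_all //; lia.
have e1 : GAPIP x1 x1 = Some true.
  by apply: GAPIP_true; rewrite count_dot_all //; lia.
have := errP e0; have := errP e1; rewrite Pr_answer_true_false.
have -> : Pr (smp_dist rho P) (fun w => answer x0 x0 w == true) =
    Pr (smp_dist rho P) (fun w => answer x1 x1 w == true).
  rewrite !PrE; apply: eq_Ex_supp => w w0.
  have [a0 b0] := nil x0 x0 w w0; have [a1 b1] := nil x1 x1 w w0.
  by rewrite /answer a0 b0 a1 b1.
move: delta_lt; lra.
Qed.

Local Notation c := (smp_cost rho P).
Let i0 : 'I_m := Ordinal (ltnW m_gt1).
Let i1 : 'I_m := Ordinal m_gt1.

Let inA (x : input) : input := [ffun i => set1 i1 (x i)].
Let inB (y : input) : input := [ffun i => set1 i0 (y i)].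
(** The hybrid argument needs a finite message type. Casting to strings of length at most [c]
    changes nothing on executions of positive probability. *)
Let fA (w : smp_space P) (x : input) : c.-bseq bool :=
  insub_bseq c (msgA (inA x) w).
Let fB (w : smp_space P) (y : input) : c.-bseq bool :=
  insub_bseq c (msgB (inB y) w).
Let ref (w : smp_space P) (a b : c.-bseq bool) : bool := referee (s := P) a b w.2.2.

Lemma acceptE x y : accept (smp_dist rho P) fA fB ref x y =
  Pr (smp_dist rho P) (fun w => answer (inA x) (inB y) w == true).
Proof.
rewrite PrE; apply: eq_Ex_supp => w w0; have := msg_size_le (inA x) (inB y) w0.
move=> h; rewrite /ref /fA /fB !val_insub_bseq ?eqb_id //.
  exact: leq_trans (leq_addl _ _) h.
exact: leq_trans (leq_addr _ _) h.
Qed.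

Lemma accept_hi (x y : input) :
  (2 * n <= 3 * #|[set i : 'I_n | (sign_ip R i0 i1 (x i) (y i) == -1)%R]|)%N ->
  2 / 3 <= accept (smp_dist rho P) fA fB ref x y.
Proof.
move=> h; rewrite acceptE; have /errP : GAPIP (inA x) (inB y) = Some true.
  apply: GAPIP_true; move: h; congr (_ <= 3 * #|pred_of_set _|)%N.
  by apply/finset.setP => i; rewrite !inE !ffunE sgn2_eqN1.
move: delta_lt; lra.
Qed.

Lemma accept_lo (x y : input) :
  (2 * n <= 3 * #|[set i : 'I_n | (sign_ip R i0 i1 (x i) (y i) == 1)%R]|)%N ->
  accept (smp_dist rho P) fA fB ref x y <= 1 / 3.
Proof.
move=> h; rewrite acceptE; have /errP : GAPIP (inA x) (inB y) = Some false.
  apply: GAPIP_false; move: h; congr (_ <= 3 * #|pred_of_set _|)%N.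
  by apply/finset.setP => i; rewrite !inE !ffunE sgn2_eq1.
rewrite Pr_answer_true_false; move: delta_lt; lra.
Qed.

Hypothesis n8 : (8 <= n)%N.
Hypothesis npow : exists t, n = (2 ^ t)%N.

Lemma card_G : (#|G|%:R : R) = n%:R ^+ 8.
Proof.
have [t nt] := npow; rewrite card_mx card_Fp // mul1n nt trunc_expnK //.
by rewrite -natrX mulnC expnM.
Qed.

Let theta : R := ((24 * n)%:R)^-1.

(** The left side is 1/12 + 32 / n^3, at most 1/12 + 1/16 once [n] is at least 8; vectors of length
    8 log n make [bias] equal to 16 / n^4. *)
Lemma small_advantage :
  2 * (n%:R * (theta + 2 * (8 * n%:R ^+ 4) / #|G|%:R)) < 6^-1.
Proof.
have nR : (8 : R) <= n%:R by rewrite ler_nat.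
have n0 : 0 < n%:R :> R by lra.
have -> : 2 * (n%:R * (theta + 2 * (8 * n%:R ^+ 4) / #|G|%:R)) =
    12^-1 + 32 * (n%:R^-1) ^+ 3.
  rewrite card_G /theta natrM; field.
  by rewrite gt_eqF.
have : (n%:R^-1 : R) <= 8^-1 by rewrite lef_pV2 ?posrE.
have : 0 < (n%:R^-1 : R) by rewrite invr_gt0.
move: (n%:R^-1) => v v0 v8.
have : v ^+ 3 <= 8^-1 ^+ 3 by rewrite lerXn2r // nnegrE; lra.
lra.
Qed.

Lemma collision_of_gapip : exists Q : col_protocol R U V n,
  is_collision rho Q n%:R^-1 /\ (col_complexity rho Q <= 96 * (1156 * c))%N.
Proof.
have nR : (8 : R) <= n%:R by rewrite ler_nat.
have i01 : i0 != i1 by [].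
have opT : op_bounded (fun a b => sign_ip R i0 i1 b a) (4 * #|G|%:R).
  move=> h; have := sign_ip_op i1 i0 h.
  by under eq_bigr do under eq_bigr do rewrite sign_ipC.
have sA a b : sign_ip R i0 i1 (flip i0 a) b = - sign_ip R i0 i1 a b.
  by rewrite sign_ip_flipA // sgn2_set1 mulrN1.
have sB a b : sign_ip R i0 i1 a (flip i1 b) = - sign_ip R i0 i1 a b.
  by rewrite sign_ip_flipB 1?eq_sym // sgn2_set1 mulrN1.
have lam0 : 0 <= 4 * #|G|%:R :> R by rewrite mulr_ge0.
have r0 : 0 < 8 * n%:R ^+ 4 :> R by rewrite mulr_gt0 // exprn_gt0 //; lra.
have rE : (8 * n%:R ^+ 4) ^+ 2 = 4 * #|G|%:R * 16 :> R by rewrite card_G; ring.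
have theta0 : 0 <= theta by rewrite invr_ge0.
have c1 : (1 : R) <= c%:R by rewrite (ler_nat _ 1) GAPIP_cost_gt0.
have L0 : 0 < 2 * c%:R :> R by lra.
have leL : ln (#|{: c.-bseq bool}|%:R : R) <= 2 * c%:R.
  apply: (@le_trans _ _ (ln (2 ^+ c.+1))).
    rewrite ler_ln ?posrE ?exprn_gt0 //.
      by rewrite -natrX ler_nat card_bseq_bool.
    by rewrite ltr0n; apply/card_gt0P; exists [bseq].
  rewrite lnXn // -[ln 2 *+ _]mulr_natr -[c.+1%:R]natr1.
  have l2 : ln (2 : R) <= 1 by apply: (@le_ln1Dx R 1); lra.
  apply: (@le_trans _ _ (1 * (c%:R + 1))); last lra.
  by rewrite ler_wpM2r // addr_ge0.
have [x [y [nS sum_lt]]] := good_prefix 0 lam0 r0 rE (@sign_ip_op R _ i0 i1) opT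
  (fun a b => sgn2_sign R _) (@flipK _ i0) (@flipK _ i1) sA sB theta0
  accept_hi accept_lo small_advantage L0 leL.
have [phi [phiS phi_sum]] := few_to_one R nS.
pose dA := prod_dist (coinA P) (unif R (word0 (0 : G) n)).
pose dB := prod_dist (coinB P) (unif R (word0 (0 : G) n)).
pose tA (u : {ffun 'I_(smp_len P) -> U}) (s : seedA P) (z : input) : c.-bseq bool :=
  insub_bseq c (alice (s := P) (inA z) u s).
pose tB (v : {ffun 'I_(smp_len P) -> V}) (s : seedB P) (z : input) : c.-bseq bool :=
  insub_bseq c (bob (s := P) (inB z) v s).
pose a (i : 'I_n) u (s : seedA P * input) :=
  revealed 0 (tA u s.1) (16 : R) (phi i) (mix (phi i) x s.2).
pose b (i : 'I_n) v (s : seedB P * input) :=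
  revealed 0 (tB v s.1) (16 : R) (phi i) (mix (phi i) y s.2).
(* Each player completes the public prefix privately and tests whether its own message reveals
   [phi i]. Both tests succeed with probability exactly [coll_prob]; the referee's coins average
   out. *)
have probE i : Ex (slot_dist rho (smp_len P) (fun _ : 'I_n => dA) (fun _ => dB) i)
    (fun w => (a i (lefts w.1) w.2.1 && b i (rights w.1) w.2.2)%:R) =
    coll_prob 0 (smp_dist rho P) fA fB (phi i) x y.
  rewrite /coll_prob /slot_dist /smp_dist !Ex_prod_dist; apply: eq_Ex => w /=.
  rewrite !Ex_prod_dist; apply: eq_Ex => sa /=.
  under eq_Ex do rewrite Ex_prod_dist.
  rewrite Ex_exchange; apply: eq_Ex => sb.
  rewrite -[LHS](Ex_cst (coinR P)); apply: eq_Ex => sr.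
  by apply: eq_Ex => z; apply: eq_Ex => z'.
have revA i : Ex (slot_dist rho (smp_len P) (fun _ : 'I_n => dA) (fun _ => dB) i)
    (fun w => (a i (lefts w.1) w.2.1)%:R) =
    reveal_prob 0 (smp_dist rho P) fA (phi i) x.
  rewrite /reveal_prob /slot_dist /smp_dist !Ex_prod_dist; apply: eq_Ex => w /=.
  rewrite !Ex_prod_dist; apply: eq_Ex => sa /=.
  under eq_Ex do rewrite Ex_cst.
  rewrite -[LHS](Ex_cst (coinB P)); apply: eq_Ex => sb.
  by rewrite -[LHS](Ex_cst (coinR P)); apply: eq_Ex => sr; apply: eq_Ex => z.
have revB i : Ex (slot_dist rho (smp_len P) (fun _ : 'I_n => dA) (fun _ => dB) i)
    (fun w => (b i (rights w.1) w.2.2)%:R) =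
    reveal_prob 0 (smp_dist rho P) fB (phi i) y.
  rewrite /reveal_prob /slot_dist /smp_dist !Ex_prod_dist; apply: eq_Ex => w /=.
  rewrite !Ex_prod_dist.
  apply: (@etrans _ _ (Ex (coinA P) (fun=> Ex dB (fun s => (b i (rights w) s)%:R)))).
    by rewrite /= !Ex_cst.
  apply: eq_Ex => sa; rewrite Ex_prod_dist; apply: eq_Ex => sb.
  by rewrite -[LHS](Ex_cst (coinR P)); apply: eq_Ex => sr; apply: eq_Ex => z.
have rev0 (h : smp_space P -> input -> c.-bseq bool) k z :
    0 <= reveal_prob (0 : G) (smp_dist rho P) h k z :> R.
  by do 2![apply: Ex_ge0 => ? _].
have sA0 : 0 <= \sum_k reveal_prob 0 (smp_dist rho P) fA k x.
  by apply: sumr_ge0.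
have sB0 : 0 <= \sum_k reveal_prob 0 (smp_dist rho P) fB k y.
  by apply: sumr_ge0.
have [Q0 [colQ0 costQ0]] : exists Q : col_protocol R U V n,
    is_collision rho Q (theta / 2) /\ (col_complexity rho Q <= 1156 * c)%N.
  apply: (col_of_tests (dA := dA) (dB := dB) (a := a) (b := b) (E := 288 * c%:R)).
  - by move=> i; rewrite probE; have := phiS i; rewrite inE.
  - under eq_bigr do rewrite revA.
    have := phi_sum (fun k => reveal_prob 0 (smp_dist rho P) fA k x) (fun k => rev0 _ k _).
    by move/le_trans; apply; exact: reveal_budget sB0 sum_lt.
  - under eq_bigr do rewrite revB.
    have := phi_sum (fun k => reveal_prob 0 (smp_dist rho P) fB k y) (fun k => rev0 _ k _).
    by move/le_trans; apply; apply: reveal_budget sA0 _; rewrite addrC.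
  - by rewrite natrM; exact: cap_budget.
have th1 : 0 <= theta / 2 <= 1.
  rewrite divr_ge0 //= ler_pdivrMr // mul1r.
  apply: (@le_trans _ _ 1); last by rewrite ler1n.
  by rewrite invf_le1 ?ltr0n ?ler1n muln_gt0 (ltnW n2).
have [Q [colQ costQ]] := col_amplify 96 th1 colQ0.
exists Q; split; last first.
  by apply: leq_trans costQ _; rewrite leq_mul2l costQ0 orbT.
by move=> i; apply: le_trans (colQ i); apply: amplified_ge.
Qed.

End CollisionFromSmp.

(** * Majority votes and message encoding *)

Section Majority.
Variable Z : eqType.
Implicit Types (z : Z) (v : seq Z).

(** [Z] need not be finite, so a strict majority is sought among the votes themselves; [z0] is
    returned if there is none. *)
Definition majority z0 v : Z :=
  head z0 [seq z <- v | (size v < 2 * count_mem z v)%N].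

Lemma majorityE z0 z v :
  (count (predC1 z) v < count_mem z v)%N -> majority z0 v = z.
Proof.
move=> lt_z; have sz : size v = (count_mem z v + count (predC1 z) v)%N.
  by rewrite count_predC.
have zin : z \in [seq y <- v | (size v < 2 * count_mem y v)%N].
  rewrite mem_filter sz mul2n -addnn ltn_add2l lt_z.
  by rewrite -has_pred1 has_count; apply: leq_ltn_trans lt_z.
have : majority z0 v \in [seq y <- v | (size v < 2 * count_mem y v)%N].
  rewrite /majority; case: (seq.filter _ v) zin => // y s _.
  exact: mem_head.
rewrite mem_filter => /andP[]; set y := majority z0 v => lty _.
apply/eqP; apply: contraTT lty => ney; rewrite -leqNgt sz.
have : (count_mem y v <= count (predC1 z) v)%N.
  by apply: sub_count => t /= /eqP ->.
lia.
Qed.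

End Majority.

Section PartialFunctionCode.
Variables (J M : finType) (cap L : nat).
Hypothesis JM : (#|J| * #|M| < 2 ^ L)%N.
Local Notation pfun := {ffun J -> option M}.

Definition graph (F : pfun) : {set J * M} := [set p | F p.1 == Some p.2].

Lemma graph_inj : injective graph.
Proof.
move=> F F' e; apply/ffunP => j.
have key m : (F j == Some m) = (F' j == Some m).
  by have := congr1 (fun S : {set J * M} => (j, m) \in S) e; rewrite !inE.
case Fj: (F j) => [m|]; first by have := key m; rewrite Fj eqxx => /esym/eqP.
by case F'j: (F' j) => [m|] //; have := key m; rewrite Fj F'j eqxx.
Qed.

Lemma card_graph F : #|graph F| = (\sum_j (F j != None))%N.
Proof.
transitivity (\sum_j \sum_m (F j == Some m))%N.
  rewrite pair_bigA -sum1_card big_mkcond; apply: eq_bigr => -[j m] _.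
  by rewrite inE; case: (_ == _).
apply: eq_bigr => j _; case: (F j) => [m|]; last by rewrite big1.
rewrite (bigD1 m) //= eqxx big1 // => m' m'm.
by rewrite (inj_eq Some_inj) eq_sym (negPf m'm).
Qed.

(** The graph is listed in [cap] cells of [L] bits each. The strict inequality in [JM] leaves a
    symbol for an empty cell. *)
Lemma pfun_code : exists (enc : pfun -> seq bool) (dec : seq bool -> pfun),
  (forall F, (#|graph F| <= cap)%N -> dec (enc F) = F) /\
  (forall F, size (enc F) = (cap * L)%N).
Proof.
pose T := {ffun 'I_cap -> option (J * M)}.
pose listing (F : pfun) : T :=
  [ffun k : 'I_cap => nth None (map Some (enum (graph F))) k].
have cardT : (#|{: T}| <= #|{: (cap * L).-tuple bool}|)%N.
  rewrite card_ffun card_ord card_option card_prod card_tuple card_bool.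
  rewrite [(cap * L)%N]mulnC expnM; case: (posnP cap) => [->|cap0]; first by rewrite !expn0.
  by rewrite leq_exp2r.
pose enc (F : pfun) : seq bool := enum_val (widen_ord cardT (enum_rank (listing F))).
(* [enc] is injective only on graphs of size at most [cap], so decoding searches among those. *)
pose dec (s : seq bool) : pfun :=
  odflt [ffun=> None] [pick F | (#|graph F| <= cap)%N && (enc F == s)].
have mem_graph F p : (#|graph F| <= cap)%N ->
    (p \in graph F) = [exists k, listing F k == Some p].
  move=> le_cap; apply/idP/existsP => [pF|[k]].
    have lt_p : (index p (enum (graph F)) < #|graph F|)%N.
      by rewrite cardE index_mem mem_enum.
    exists (Ordinal (leq_trans lt_p le_cap)); rewrite ffunE /=.
    by rewrite (nth_map p) -?cardE // nth_index ?mem_enum.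
  rewrite ffunE; have [lt_k|ge_k] := ltnP k (size (enum (graph F))).
    by rewrite (nth_map p) // => /eqP[<-]; rewrite -mem_enum mem_nth.
  by rewrite nth_default ?size_map.
have enc_inj F F' : (#|graph F| <= cap)%N -> (#|graph F'| <= cap)%N ->
    enc F = enc F' -> F = F'.
  move=> leF leF' /val_inj/enum_val_inj/(congr1 val)/= /ord_inj/enum_rank_inj e.
  by apply: graph_inj; apply/finset.setP => p; rewrite !mem_graph // e.
exists enc, dec; split=> [F leF|F]; last by rewrite size_tuple.
rewrite /dec; case: pickP => [F' /andP[leF' /eqP e]|/(_ F)] /=.
  exact: enc_inj.
by rewrite leF eqxx.
Qed.

End PartialFunctionCode.

Section Bernoulli.
Variables (R : realType) (p : R).
Hypothesis p01 : 0 <= p <= 1.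

Lemma bern_ge0 (b : bool) : 0 <= (if b then p else 1 - p).
Proof. by case/andP: p01 => p0 p1; case: b; rewrite ?subr_ge0. Qed.

Lemma bern_sum1 : \sum_(b : bool) (if b then p else 1 - p) = 1.
Proof. by rewrite big_bool /= addrC subrK. Qed.

Definition bern : dist R bool := Dist bern_ge0 bern_sum1.

Lemma Ex_bern (phi : bool -> R) : Ex bern phi = p * phi true + (1 - p) * phi false.
Proof. by rewrite /Ex big_bool. Qed.

End Bernoulli.

(** * From collisions to protocols *)

Lemma col_complexity_gt0 (R : realType) (U V : finType) (rho : dist R (U * V)%type)
    (n : nat) (P : col_protocol R U V n) :
  (0 < n)%N -> is_collision rho P n%:R^-1 -> (0 < col_complexity rho P)%N.
Proof.
move=> n0 colP; have := colP (Ordinal n0); rewrite PrE => h.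
have : 0 < n%:R^-1 :> R by rewrite invr_gt0 ltr0n.
move/lt_le_trans => /(_ _ h)/Ex_gt_witness[w w0].
rewrite ltr0n lt0b inE => /andP[iA _].
apply: leq_trans (@leq_bigmax_cond (col_space P) (fun v => 0 < col_dist rho P v)
    (fun v => maxn #|outA v| #|outB v|) w w0).
by rewrite leq_max; apply/orP; left; apply/card_gt0P; exists (Ordinal n0).
Qed.

Lemma expRN3_le (R : realType) : expR (- 3%:R) <= 8^-1 :> R.
Proof.
rewrite expRN lef_pV2 ?posrE ?expR_gt0 // -[3%:R]mulr1 expRM_natl.
have -> : (8 : R) = 2 ^+ 3 by ring.
rewrite lerXn2r ?nnegrE ?expR_ge0 //.
by apply: le_trans (expR_ge1Dx 1); lra.
Qed.

Section Budget.
Variable R : realType.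
Implicit Types A B c s : R.

Lemma markov_budget A B s : 0 < s -> A <= 54 * s -> B <= 54 * s ->
  (A + B) / (1080 * s) <= 10^-1.
Proof.
move=> s0 hA hB; have c0 : 0 < 1080 * s by lra.
by rewrite (ler_pdivrMr _ _ c0); lra.
Qed.

(** 1/8 for a wrong majority and 1/10 for an overflow add up to 9/40, which is below 1/3. *)
Lemma error_budget A B : A <= 8^-1 -> B <= 10^-1 -> 1 - 9 / 40 <= 1 - A - B.
Proof. lra. Qed.

Lemma overflow_le0 A B c : 0 < c -> 0 <= A -> 0 <= B -> (c < A) || (c < B) ->
  1 - (A + B) / c <= 0.
Proof.
move=> c0 A0 B0 /orP h; rewrite subr_le0 ler_pdivlMr // mul1r.
by case: h => h; lra.
Qed.

End Budget.

Section SmpFromCollision.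
Variables (R : realType) (U V : finType) (rho : dist R (U * V)%type) (n : nat).
Hypothesis n0 : (0 < n)%N.
Variable P : col_protocol R U V n.
Hypothesis colP : is_collision rho P n%:R^-1.
Variables (X Y M : finType) (Z : eqType) (z0 : Z).
Variables (a : 'I_n -> X -> M) (b : 'I_n -> Y -> M) (g : 'I_n -> M -> M -> Z).
Variable f : X -> Y -> option Z.
Hypothesis fE : forall x y z, f x y = Some z ->
  (2 * n <= 3 * #|[set i | g i (a i x) (b i y) == z]|)%N.

Local Notation J := ('I_n * 'I_54)%type.
Variable L : nat.
Hypothesis JM : (#|{: J}| * #|M| < 2 ^ L)%N.

Local Notation s := (col_complexity rho P).

Let p (i : 'I_n) : R := Pr (col_dist rho P) (fun w => i \in outA w :&: outB w).
(** Alice keeps [i] with this probability, which makes every hit probability exactly 1/n, so that no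
    index weighs more in the vote. *)
Let beta (i : 'I_n) : R := n%:R^-1 / p i.

Lemma n0R : 0 < n%:R :> R. Proof. by rewrite ltr0n. Qed.

Lemma p_gt0 i : 0 < p i.
Proof. by apply: lt_le_trans (colP i); rewrite invr_gt0 n0R. Qed.

Lemma beta01 i : 0 <= beta i <= 1.
Proof.
apply/andP; split; first by rewrite divr_ge0 ?invr_ge0 // ltW // p_gt0.
by rewrite ler_pdivrMr ?p_gt0 // mul1r; apply: colP.
Qed.

Let dA (j : J) := prod_dist (ccoinA P) (bern (beta01 j.1)).
Let dB (j : J) := ccoinB P.
Let base := slot_dist rho (col_len P) dA dB.
Local Notation slot := (slot_space U V (cseedA P * bool)%type (cseedB P) (col_len P)).

Let tA (j : J) (w : slot) := (j.1 \in csetA (c := P) (lefts w.1) w.2.1.1) && w.2.1.2.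
Let tB (j : J) (w : slot) := j.1 \in csetB (c := P) (rights w.1) w.2.2.
Let hit (j : J) (w : slot) := tA j w && tB j w.

Lemma Ex_base (j : J) (phi : slot -> R) :
  Ex (base j) phi =
  Ex (col_dist rho P) (fun w => beta j.1 * phi (w.1, (w.2.1, true, w.2.2)) +
     (1 - beta j.1) * phi (w.1, (w.2.1, false, w.2.2))).
Proof.
rewrite /base /slot_dist /col_dist !Ex_prod_dist; apply: eq_Ex => w /=.
rewrite !Ex_prod_dist; apply: eq_Ex => sa.
by rewrite Ex_bern /= -!ExZ -ExD.
Qed.

Lemma hit_prob j : Ex (base j) (fun w => (hit j w)%:R) = n%:R^-1.
Proof.
rewrite Ex_base /hit /tA /=.
under eq_Ex do rewrite andbT andbF /= mulr0 addr0.
rewrite ExZ -(mulfVK (lt0r_neq0 (p_gt0 j.1)) n%:R^-1); congr (_ * _).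
by rewrite /p PrE; apply: eq_Ex => w; rewrite inE.
Qed.

Lemma sum_in_out (t : col_space P -> {set 'I_n}) :
  (forall w, 0 < col_dist rho P w -> (#|t w| <= s)%N) ->
  \sum_(i < n) Ex (col_dist rho P) (fun w => (i \in t w)%:R) <= s%:R.
Proof.
move=> le_s; rewrite -Ex_sum -[leRHS](Ex_cst (col_dist rho P)); apply: le_Ex => w w0.
by rewrite -(card_sum_mem _ (fun i => erefl (i \in t w))) ler_nat le_s.
Qed.

Lemma out_le w : 0 < col_dist rho P w ->
  (#|outA w| <= s)%N /\ (#|outB w| <= s)%N.
Proof.
move=> w0; have := @leq_bigmax_cond (col_space P) (fun v => 0 < col_dist rho P v)
  (fun v => maxn #|outA v| #|outB v|) w w0.
by rewrite geq_max => /andP h; exact: h.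
Qed.

Lemma sum_J (F : 'I_n -> R) : \sum_(j : J) F j.1 = 54 * \sum_i F i.
Proof.
rewrite -(pair_bigA _ (fun i (k : 'I_54) => F i)) /= mulr_sumr.
by apply: eq_bigr => i _; rewrite sumr_const card_ord -[LHS]mulr_natl.
Qed.

Lemma mean_A : \sum_j Ex (base j) (fun w => (tA j w)%:R) <= 54 * s%:R.
Proof.
apply: (@le_trans _ _ (\sum_(j : J) Ex (col_dist rho P) (fun w => (j.1 \in outA w)%:R))).
  apply: ler_sum => j _; rewrite Ex_base; apply: le_Ex => w _.
  rewrite /tA /= andbT andbF mulr0 addr0 ler_piMl //.
  by case/andP: (beta01 j.1).
rewrite (sum_J (fun i => Ex _ (fun w => (i \in outA w)%:R))) ler_pM2l //.
by apply: sum_in_out => w /out_le[].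
Qed.

Lemma mean_B : \sum_j Ex (base j) (fun w => (tB j w)%:R) <= 54 * s%:R.
Proof.
apply: (@le_trans _ _ (\sum_(j : J) Ex (col_dist rho P) (fun w => (j.1 \in outB w)%:R))).
  apply: ler_sum => j _; rewrite Ex_base; apply: le_Ex => w _.
  by rewrite /tB /= -mulrDl addrC subrK mul1r.
rewrite (sum_J (fun i => Ex _ (fun w => (i \in outB w)%:R))) ler_pM2l //.
by apply: sum_in_out => w /out_le[].
Qed.

Section Votes.
Variables (x : X) (y : Y) (z : Z).
Let good (i : 'I_n) := g i (a i x) (b i y) == z.

Let right (w : {ffun J -> slot}) := (\sum_j (hit j (w j) && good j.1))%N.
Let wrong (w : {ffun J -> slot}) := (\sum_j (hit j (w j) && ~~ good j.1))%N.

(* A slot multiplies the potential by 2/3 when it casts a right vote and by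
   3/2 when it casts a wrong one; with twice as many right slots as wrong ones
   the expected potential is at most [exp (-3)]. *)
Lemma wrong_majority : f x y = Some z ->
  Ex (pdist base) (fun w => (right w <= wrong w)%N%:R) <= 8^-1.
Proof.
move=> /fE; rewrite -/(good _) => many_good.
pose om j (w : slot) : R :=
  (2 / 3) ^+ (hit j w && good j.1) * (3 / 2) ^+ (hit j w && ~~ good j.1).
apply: (@le_trans _ _ (Ex (pdist base) (fun w => \prod_j om j (w j)))).
  apply: le_Ex => w _; rewrite /om big_split !prodrXr -/(right w) -/(wrong w).
  case: leqP => [le_rw|_] /=; last by rewrite mulr_ge0 // exprn_ge0 //; lra.
  rewrite -(subnK le_rw) exprD mulrCA -exprMn.
  have -> : (2 / 3 * (3 / 2) : R) = 1 by field.
  by rewrite expr1n mulr1 exprn_ege1 //; lra.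
(* The relative change of the potential at a hit; a slot therefore has mean factor 1 + kap / n. *)
pose kap (i : 'I_n) : R := if good i then - (1 / 3) else 1 / 2.
rewrite Ex_pdist_prod; apply: (@le_trans _ _ (\prod_(j : J) expR (kap j.1 / n%:R))).
  apply: ler_prod => j _; apply/andP; split.
    by apply: Ex_ge0 => w _; rewrite mulr_ge0 // exprn_ge0 //; lra.
  apply: le_trans (expR_ge1Dx _).
  have -> : Ex (base j) (om j) = Ex (base j) (fun w => 1 + (hit j w)%:R * kap j.1).
    apply: eq_Ex => w; rewrite /om /kap.
    by case: (hit j w); case: (good j.1); rewrite /= ?expr0 ?expr1; lra.
  by rewrite ExD Ex_cst ExZr hit_prob mulrC.
rewrite -expR_sum; apply: le_trans (expRN3_le R); rewrite ler_expR.
rewrite (sum_J (fun i => kap i / n%:R)) -mulr_suml.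
(* With at least 2n/3 good indices the sum is at most n/2 - 5n/9 = -n/18, and 54 repetitions make
   the exponent -3. *)
have -> : \sum_i kap i = n%:R * (1 / 2) - 5 / 6 * #|[set i | good i]|%:R.
  rewrite (card_sum_mem R (a := good)); last by move=> i; rewrite inE.
  rewrite mulr_sumr -[n in n%:R]card_ord mulr_natl -sumr_const -sumrB.
  by apply: eq_bigr => i _; rewrite /kap; case: (good i) => /=; lra.
rewrite mulrA ler_pdivrMr ?n0R //.
have : (2 * n%:R : R) <= 3 * #|[set i | good i]|%:R by rewrite -!natrM ler_nat.
lra.
Qed.

End Votes.

(** Each player sends a partial function from slots to local messages; the referee votes over the
    slots that both announced. The cap is ten times the two expected sizes together, and two
    messages of [cap * L] bits give 2160. *)
Lemma smp_of_collision : exists Q : smp_protocol R U V X Y Z,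
  has_error rho Q f (9 / 40) /\ (smp_cost rho Q <= 2160 * s * L)%N.
Proof.
have [cap capE] : exists k, k = (1080 * s)%N by exists (1080 * s)%N.
have [enc [dec [encK size_enc]]] := @pfun_code J M cap L JM.
pose FA x (t : J -> bool) : {ffun J -> option M} :=
  [ffun j => if t j then Some (a j.1 x) else None].
pose FB y (t : J -> bool) : {ffun J -> option M} :=
  [ffun j => if t j then Some (b j.1 y) else None].
pose vote (F F' : {ffun J -> option M}) (j : J) : option Z :=
  if F j is Some m then if F' j is Some m' then Some (g j.1 m m') else None else None.
pose Q : smp_protocol R U V X Y Z := {|
  coinA := pdist dA; coinB := pdist dB; coinR := unif R tt;
  alice := fun x u (sd : {ffun J -> cseedA P * bool}) =>
    enc (FA x (fun j => (j.1 \in csetA (c := P) (slot_samples u j) (sd j).1) && (sd j).2));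
  bob := fun y v (sd : {ffun J -> cseedB P}) =>
    enc (FB y (fun j => j.1 \in csetB (c := P) (slot_samples v j) (sd j)));
  referee := fun mA mB _ => majority z0 (pmap (vote (dec mA) (dec mB)) (enum {: J})) |}.
exists Q; split; last first.
  apply/bigmax_leqP => x _; apply/bigmax_leqP => y _; apply/bigmax_leqP => w _.
  rewrite /msgA /msgB /= !size_enc capE; lia.
move=> x y z fxy; rewrite PrE.
pose cntA (w : {ffun J -> slot}) : R := \sum_j (tA j (w j))%:R.
pose cntB (w : {ffun J -> slot}) : R := \sum_j (tB j (w j))%:R.
pose right (w : {ffun J -> slot}) :=
  (\sum_j (hit j (w j) && (g j.1 (a j.1 x) (b j.1 y) == z)))%N.
pose wrong (w : {ffun J -> slot}) :=
  (\sum_j (hit j (w j) && (g j.1 (a j.1 x) (b j.1 y) != z)))%N.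
have s0 : (0 < s)%N := col_complexity_gt0 n0 colP.
have s0R : 0 < s%:R :> R by rewrite ltr0n.
(* A pointwise lower bound for correctness, combining the union bound with Markov's inequality. *)
pose bound (w : {ffun J -> slot}) : R :=
  1 - (right w <= wrong w)%N%:R - (cntA w + cntB w) / cap%:R.
apply: (@le_trans _ _ (Ex (pdist base) bound)).
  have EA : Ex (pdist base) cntA = \sum_j Ex (base j) (fun w => (tA j w)%:R).
    rewrite Ex_sum; apply: eq_bigr => j _.
    exact: (Ex_pdist_coord base j (fun w => (tA j w)%:R)).
  have EB : Ex (pdist base) cntB = \sum_j Ex (base j) (fun w => (tB j w)%:R).
    rewrite Ex_sum; apply: eq_bigr => j _.
    exact: (Ex_pdist_coord base j (fun w => (tB j w)%:R)).
  rewrite /bound !ExB Ex_cst ExZr ExD EA EB.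
  apply: error_budget; first exact: wrong_majority fxy.
  by rewrite capE natrM; apply: markov_budget; [|exact: mean_A|exact: mean_B].
apply: (@le_trans _ _ (Ex (slots_dist rho (col_len P) dA dB)
    (fun w => (answer (P := Q) x y (w.1, (w.2, tt)) == z)%:R))); last first.
  rewrite /smp_dist !Ex_prod_dist; apply: ler_sum => w _.
  rewrite ler_wpM2l ?mass_ge0 // !Ex_prod_dist; apply: ler_sum => sa _.
  rewrite ler_wpM2l ?mass_ge0 //; apply: ler_sum => sb _.
  rewrite ler_wpM2l ?mass_ge0 // -[leLHS](Ex_cst (unif R tt)).
  by apply: le_Ex => -[].
rewrite -Ex_slots; apply: le_Ex => w _; rewrite [leLHS]/=; set sl := slots_of w.
have FAE : msgA (P := Q) x (w.1, (w.2, tt)) = enc (FA x (fun j => tA j (sl j))).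
  rewrite /msgA /=; congr enc; apply/ffunP => j; rewrite !ffunE /tA /=.
  by rewrite lefts_slot.
have FBE : msgB (P := Q) y (w.1, (w.2, tt)) = enc (FB y (fun j => tB j (sl j))).
  rewrite /msgB /=; congr enc; apply/ffunP => j; rewrite !ffunE /tB /=.
  by rewrite rights_slot.
have cardA : (#|graph (FA x (fun j => tA j (sl j)))|%:R : R) = cntA sl.
  rewrite card_graph natr_sum; apply: eq_bigr => j _.
  by rewrite !ffunE; case: (tA _ _).
have cardB : (#|graph (FB y (fun j => tB j (sl j)))|%:R : R) = cntB sl.
  rewrite card_graph natr_sum; apply: eq_bigr => j _.
  by rewrite !ffunE; case: (tB _ _).
have cap0 : 0 < cap%:R :> R by rewrite ltr0n capE muln_gt0.
have cA0 : 0 <= cntA sl by apply: sumr_ge0.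
have cB0 : 0 <= cntB sl by apply: sumr_ge0.
have q0 : 0 <= (cntA sl + cntB sl) / cap%:R.
  by apply: divr_ge0; [exact: addr_ge0 | exact: ltW].
have ans0 : 0 <= (answer (P := Q) x y (w.1, (w.2, tt)) == z)%:R :> R by exact: ler0n.
rewrite /bound.
have [le_rw|lt_wr] := leqP (right sl) (wrong sl).
  by apply: le_trans ans0; rewrite subrr sub0r oppr_le0.
(* Beyond the cap decoding may fail, but there the bound is nonpositive. *)
rewrite subr0; have [over|] := boolP ((cap%:R < cntA sl) || (cap%:R < cntB sl)).
  by apply: le_trans ans0; apply: overflow_le0.
rewrite negb_or -!leNgt => /andP[cA cB].
suff -> : answer (P := Q) x y (w.1, (w.2, tt)) = z.
  by rewrite eqxx lerBlDr lerDl.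
rewrite /answer FAE FBE /= !encK; [|by rewrite -(ler_nat R) cardB|by rewrite -(ler_nat R) cardA].
apply: majorityE.
have voteE j : vote (FA x (fun j => tA j (sl j))) (FB y (fun j => tB j (sl j))) j =
    if hit j (sl j) then Some (g j.1 (a j.1 x) (b j.1 y)) else None.
  by rewrite /vote !ffunE /hit; case: (tA _ _); case: (tB _ _).
have countE (q : pred Z) : count q (pmap (vote (FA x (fun j => tA j (sl j)))
    (FB y (fun j => tB j (sl j)))) (enum {: J})) =
    (\sum_j (hit j (sl j) && q (g j.1 (a j.1 x) (b j.1 y))))%N.
  rewrite -big_enum /=; elim: (enum _) => [|j r IH]; first by rewrite big_nil.
  by rewrite big_cons /= voteE; case: (hit _ _) => /=; rewrite IH.
by rewrite !countE.
Qed.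

End SmpFromCollision.

(** * Derandomization *)

Lemma pow89_le (R : realType) : (8 / 9 : R) ^+ 54 <= 512^-1.
Proof.
have -> : (512^-1 : R) = (2^-1) ^+ 9 by rewrite exprVn; congr (_^-1); ring.
have -> : ((8 / 9 : R) ^+ 54) = ((8 / 9) ^+ 6) ^+ 9 by rewrite -exprM.
by rewrite lerXn2r ?nnegrE ?exprn_ge0 //; lra.
Qed.

Lemma two_thirds (k l m n : nat) :
  (l <= m -> k + l = n -> 3 * k <= n -> 2 * n <= 3 * m)%N.
Proof. lia. Qed.

Section Newman.
Variables (R : realType) (Om X Y : finType) (Z : eqType) (n : nat).
Hypothesis n0 : (0 < n)%N.
Hypothesis cardXY : (#|X| * #|Y| <= 4 ^ n)%N.
Variables (d : dist R Om) (f : X -> Y -> option Z) (ans : X -> Y -> Om -> Z).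
Hypothesis ans_err : forall x y z, f x y = Some z ->
  Ex d (fun w => (ans x y w != z)%:R) <= 3^-1.

Local Notation block := {ffun 'I_108 -> Om}.
Let dblock := pdist (fun _ : 'I_108 => d).
Let dall := pdist (fun _ : 'I_n => dblock).

Let errs x y z (b : block) : nat := (\sum_k (ans x y (b k) != z))%N.
Let bad x y z (b : block) : bool := (54 <= errs x y z b)%N.

(** Exponential Markov: [2 ^+ errs] has mean at most (4/3)^108 and is at least 2^54 on a bad block,
    and the quotient is (8/9)^54. With fewer than 54 errors among 108 runs the majority is right. *)
Lemma bad_block x y z : f x y = Some z -> Ex dblock (fun b => (bad x y z b)%:R) <= 512^-1.
Proof.
move=> fxy; apply: le_trans (pow89_le R).
apply: (@le_trans _ _ (Ex dblock (fun b =>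
    (\prod_k (1 + (ans x y (b k) != z)%:R)) * (2^-1) ^+ 54))).
  apply: le_Ex => b _; rewrite /bad.
  have -> : \prod_k (1 + (ans x y (b k) != z)%:R) = 2 ^+ errs x y z b :> R.
    rewrite /errs -prodrXr; apply: eq_bigr => k _.
    by case: (_ != _); rewrite ?addr0.
  have [le54|_] := leqP 54 (errs x y z b); last first.
    by rewrite /= mulr0n; apply: mulr_ge0; apply: exprn_ge0; rewrite ?invr_ge0 ler0n.
  rewrite -(subnK le54) exprD -mulrA -exprMn divff ?pnatr_eq0 // expr1n mulr1.
  by rewrite exprn_ege1 // ler1n.
rewrite ExZr (Ex_pdist_prod _ (fun _ w => 1 + (ans x y w != z)%:R)) /=.
have -> : (8 / 9 : R) ^+ 54 = (4 / 3) ^+ 108 * 2^-1 ^+ 54.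
  by rewrite (_ : 108 = 2 * 54)%N // exprM -exprMn; congr (_ ^+ _); field.
rewrite ler_wpM2r ?exprn_ge0 // -[in leRHS](card_ord 108) -prodr_const.
apply: ler_prod => k _; rewrite ExD Ex_cst; apply/andP; split.
  by rewrite addr_ge0 // Ex_ge0.
by have := ans_err fxy; lra.
Qed.

(** Exponential Markov again, with factor 512 = 8^3 per bad block against 8^n; one block contributes
    at most (1 + 511/512) / 8 = 1023/4096. This is below 1/4, which beats a union bound over 4^n
    input pairs. *)
Lemma many_bad x y z : f x y = Some z ->
  Ex dall (fun w => (n < 3 * \sum_i bad x y z (w i))%N%:R) <= (1023 / 4096) ^+ n.
Proof.
move=> fxy; apply: (@le_trans _ _ (Ex dall (fun w =>
    \prod_i ((1 + 511 * (bad x y z (w i))%:R) / 8)))).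
  apply: le_Ex => w _; rewrite big_split prodr_const card_ord /=.
  have -> : \prod_i (1 + 511 * (bad x y z (w i))%:R) =
      8 ^+ (3 * \sum_i bad x y z (w i)) :> R.
    rewrite exprM -prodrXr; apply: eq_bigr => i _.
    by case: (bad _ _ _ _); rewrite ?expr1 ?expr0 ?mulr0 ?addr0 //=; ring.
  have [lt_n|_] := ltnP n (3 * \sum_i bad x y z (w i)); last first.
    by rewrite /= mulr0n; apply: mulr_ge0; apply: exprn_ge0; rewrite ?invr_ge0 ler0n.
  rewrite -(subnK (ltnW lt_n)) exprD -mulrA -exprMn divff ?pnatr_eq0 //.
  by rewrite expr1n mulr1 exprn_ege1 // ler1n.
rewrite (Ex_pdist_prod _ (fun _ b => (1 + 511 * (bad x y z b)%:R) / 8)) /=.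
rewrite -[in leRHS](card_ord n) -prodr_const; apply: ler_prod => i _.
rewrite ExZr ExD Ex_cst ExZ; have := bad_block fxy.
have : 0 <= Ex dblock (fun b => (bad x y z b)%:R) by exact: Ex_ge0.
by move: (Ex _ _) => q q0 q1; apply/andP; split; lra.
Qed.

(** Besides surviving the union bound, the fixed samples must all have positive mass, so that the
    messages computed from them respect the cost bound. *)
Lemma newman (z0 : Z) : exists w : 'I_n -> 'I_108 -> Om,
  (forall i k, 0 < d (w i k)) /\
  (forall x y z, f x y = Some z -> (2 * n <= 3 * #|[set i |
     majority z0 [seq ans x y (w i k) | k <- enum 'I_108] == z]|)%N).
Proof.
pose fail (p : X * Y) (w : {ffun 'I_n -> block}) : bool :=
  if f p.1 p.2 is Some z then (n < 3 * \sum_i bad p.1 p.2 z (w i))%N else false.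
have [c0 c1] : 0 <= (1023 / 4096 : R) /\ 4 * (1023 / 4096) < (1 : R) by split; lra.
have := many_bad; move: (1023 / 4096) c0 c1 => c c0 c1 few_bad.
have : 0 < Ex dall (fun w => 1 - \sum_p (fail p w)%:R).
  rewrite ExB Ex_cst Ex_sum subr_gt0.
  apply: (@le_lt_trans _ _ (\sum_(p : X * Y) c ^+ n)).
    apply: ler_sum => -[x y] _; rewrite /fail /=; case fxy: (f x y) => [z|].
      exact: few_bad.
    by rewrite Ex_cst exprn_ge0.
  rewrite sumr_const card_prod -[ltLHS]mulr_natl.
  apply: (@le_lt_trans _ _ ((4 ^ n)%:R * c ^+ n)).
    by rewrite ler_wpM2r ?ler_nat // exprn_ge0.
  by rewrite natrX -exprMn exprn_ilt1 -?lt0n // mulr_ge0.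
case/Ex_gt_witness => w w_gt0; rewrite subr_gt0 => few.
exists (fun i k => w i k); split=> [i k|x y z fxy].
  exact: (pdist_gt0 k (pdist_gt0 i w_gt0)).
have nofail : ~~ fail (x, y) w.
  apply/negP => fl; move: few; rewrite (bigD1 (x, y)) //= fl /= ltNge lerDl.
  by rewrite sumr_ge0.
move: nofail; rewrite /fail /= fxy -leqNgt.
rewrite (_ : (\sum_i bad x y z (w i))%N = #|[set i | bad x y z (w i)]|); last first.
  rewrite -sum1_card [RHS]big_mkcond; apply: eq_bigr => i _.
  by rewrite inE; case: (bad _ _ _ _).
have := cardsC [set i | bad x y z (w i)]; rewrite card_ord.
have : (#|~: [set i | bad x y z (w i)]| <=
    #|[set i | majority z0 [seq ans x y (w i k) | k <- enum 'I_108] == z]|)%N.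
  apply: subset_leq_card; apply/fintype.subsetP => i; rewrite !inE /bad -ltnNge => lt54.
  apply/eqP; apply: majorityE; set v := [seq _ | _ <- _].
  have errE : count (predC1 z) v = errs x y z (w i).
    rewrite /v /errs -big_enum /=; elim: (enum _) => [|k r IH]; first by rewrite big_nil.
    by rewrite big_cons /= IH.
  have : (count_mem z v + count (predC1 z) v = 108)%N.
    by rewrite count_predC size_map size_enum_ord.
  by rewrite errE; move: lt54; move: (errs _ _ _ _) (count_mem _ _) => A B; lia.
exact: two_thirds.
Qed.

End Newman.

(** * Protocols without communication *)

Section Silent.
Variables (R : realType) (U V U' V' X Y : finType) (Z : eqType).
Variables (rho : dist R (U * V)%type) (rho' : dist R (U' * V')%type).
Variables (P : smp_protocol R U V X Y Z) (f : X -> Y -> option Z) (delta : R).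

(** If [P] costs nothing, the bound to be proved is 0 and no vote is affordable. But then the
    referee sees empty messages and answers from its own coins, whatever the source. *)
Lemma silent_transfer : has_error rho P f delta -> smp_cost rho P = 0%N ->
  exists Q : smp_protocol R U' V' X Y Z,
    has_error rho' Q f delta /\ smp_cost rho' Q = 0%N.
Proof.
move=> errP c0; pose Q : smp_protocol R U' V' X Y Z := {| smp_len := 0;
  coinA := unif R tt; coinB := unif R tt; coinR := coinR P;
  alice := fun _ _ _ => [::]; bob := fun _ _ _ => [::]; referee := referee (s := P) |}.
exists Q; split; last first.
  by apply/eqP; rewrite -leqn0; apply/bigmax_leqP => x _; apply/bigmax_leqP => y _;
     apply/bigmax_leqP.
move=> x y z /errP h; apply: le_trans h _; rewrite le_eqVlt; apply/orP; left.
apply/eqP; rewrite !PrE.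
transitivity (Ex (smp_dist rho P)
    (fun w => (referee (s := P) [::] [::] w.2.2 == z)%:R)).
  apply: eq_Ex_supp => w /(msg_size_le x y); rewrite c0 leqn0 addn_eq0 !size_eq0.
  by rewrite /answer => /andP[/eqP -> /eqP ->].
rewrite /smp_dist !Ex_prod_dist.
have E0 (S T T' : finType) (d : dist R S) (e : dist R T) (e' : dist R T') c :
  Ex d (fun=> Ex (prod_dist e e') (fun=> c)) = c :> R by rewrite !Ex_cst.
under eq_Ex do rewrite Ex_prod_dist.
rewrite (E0 _ _ _ _ _ _ (Ex (coinR P) (fun r => (referee (s := P) [::] [::] r == z)%:R))).
under [RHS]eq_Ex do rewrite Ex_prod_dist.
by rewrite [RHS](E0 _ _ _ _ _ _ (Ex (coinR P) (fun r => (referee (s := P) [::] [::] r == z)%:R))).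
Qed.

End Silent.

(** * The theorem *)

(** Costs are natural numbers, so the infimum is attained unless it is taken over the empty set. *)
Lemma ereal_inf_natP (R : realType) (T : Type) (Q : T -> Prop) (cost : T -> nat)
    (S := [set c : \bar R | exists t, Q t /\ c = ((cost t)%:R)%:E]%classic) :
  ereal_inf S = +oo%E \/ exists2 t, Q t & ereal_inf S = ((cost t)%:R)%:E.
Proof.
have [[t Qt]|no] := pselect (exists t, Q t); last first.
  left; rewrite (_ : S = set0) ?ereal_inf0 //.
  by rewrite -subset0 => c [t [Qt _]]; apply: no; exists t.
right; have ex : exists k, `[< exists u, Q u /\ cost u = k >].
  by exists (cost t); apply/asboolP; exists t.
case: (ex_minnP ex) => k /asboolP[u [Qu uk]] kmin; exists u => //.
apply/eqP; rewrite eq_le; apply/andP; split.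
  by apply: ereal_inf_lbound; exists u.
apply: le_ereal_inf_tmp => _ [v [Qv ->]]; rewrite lee_fin ler_nat uk.
by apply: kmin; apply/asboolP; exists v.
Qed.

Lemma dist_inhabited (R : realType) (T : finType) (d : dist R T) : exists t : T, 0 < d t.
Proof.
have : 0 < Ex d (fun=> 1) by rewrite Ex_cst.
by case/Ex_gt_witness => t dt _; exists t.
Qed.

Section PolylogBounds.
Variables (R : realType) (n : nat).
Hypothesis n0 : (0 < n)%N.

Lemma trunc_log_le_log2 : (trunc_log 2 n)%:R <= log2 (n%:R : R).
Proof.
have l2 : 0 < ln (2 : R) by rewrite ln_gt0 // ltr1n.
rewrite /log2 ler_pdivlMr // mulr_natl -lnXn // ler_ln ?posrE ?exprn_gt0 ?ltr0n //.
by rewrite -natrX ler_nat trunc_logP.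
Qed.

Lemma log2_ge0 : 0 <= log2 (n%:R : R).
Proof. exact: le_trans (ler0n _ _) trunc_log_le_log2. Qed.

Lemma polylog_top (C : R) k (x : \bar R) : 0 < C -> polylog_le C k n x +oo%E.
Proof.
move=> C0; rewrite /polylog_le gt0_muley ?leey // lte_fin mulr_gt0 // exprn_gt0 //.
by have := log2_ge0; lra.
Qed.

End PolylogBounds.

Lemma cost_budget (R : realType) (s L : nat) (B D : R) : 0 <= (s%:R : R) ->
  L%:R <= B * D -> (2160 * s * L)%:R <= 2160 * B * D * s%:R.
Proof.
move=> s0 LE; rewrite [leRHS]mulrAC [2160 * B * _]mulrAC -mulrA 2!natrM.
by apply: ler_wpM2l LE; apply: mulr_ge0 s0; exact: ler0n.
Qed.

Section Costs.
Variables (R : realType) (U V : finType) (rho : dist R (U * V)%type).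

Lemma SMP_cases (X Y : finType) (Z : eqType) (f : X -> Y -> option Z) :
  SMP rho f = +oo%E \/ exists P : smp_protocol R U V X Y Z,
    (exists2 delta : R, delta < 3^-1 & has_error rho P f delta) /\
    SMP rho f = ((smp_cost rho P)%:R)%:E.
Proof.
rewrite /SMP.
have [->|[P hP e]] := ereal_inf_natP R (fun P : smp_protocol R U V X Y Z =>
  exists2 delta : R, delta < 3^-1 & has_error rho P f delta) (smp_cost rho).
  by left.
by right; exists P.
Qed.

Lemma coll_cases n :
  coll rho n = +oo%E \/ exists P : col_protocol R U V n,
    is_collision rho P n%:R^-1 /\ coll rho n = ((col_complexity rho P)%:R)%:E.
Proof.
rewrite /coll /collp.
have [->|[P hP e]] := ereal_inf_natP R (fun P : col_protocol R U V n =>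
  is_collision rho P n%:R^-1) (col_complexity rho).
  by left.
by right; exists P.
Qed.

Lemma SMP_le (X Y : finType) (Z : eqType) (f : X -> Y -> option Z)
    (P : smp_protocol R U V X Y Z) (delta : R) :
  delta < 3^-1 -> has_error rho P f delta ->
  (SMP rho f <= ((smp_cost rho P)%:R)%:E)%E.
Proof.
by move=> d3 eP; apply: ereal_inf_lbound; exists P; split => //; exists delta.
Qed.

Lemma coll_le n (P : col_protocol R U V n) : is_collision rho P n%:R^-1 ->
  (coll rho n <= ((col_complexity rho P)%:R)%:E)%E.
Proof. by move=> cP; apply: ereal_inf_lbound; exists P. Qed.

Lemma coll_trivial n : (coll rho n <= (n%:R)%:E)%E.
Proof.
pose P : col_protocol R U V n := {| col_len := 0;
  ccoinA := unif R tt; ccoinB := unif R tt;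
  csetA := fun _ _ => [set: 'I_n]; csetB := fun _ _ => [set: 'I_n] |}.
have cP : is_collision rho P n%:R^-1.
  move=> i; rewrite PrE; under eq_Ex do rewrite !inE.
  rewrite Ex_cst invf_le1 ?ler1n ?ltr0n; exact: leq_ltn_trans (ltn_ord i).
apply: le_trans (coll_le cP) _; rewrite lee_fin ler_nat; apply/bigmax_leqP => w _.
by rewrite /outA /outB /= maxnn cardsT card_ord.
Qed.

Lemma coll_gt0 n : (0 < n)%N -> (0 < coll rho n)%E.
Proof.
move=> n0; case: (coll_cases n) => [->//|[P [cP ->]]].
by rewrite lte_fin ltr0n (col_complexity_gt0 n0 cP).
Qed.

Lemma GAPIP_upper n : (2 <= n)%N ->
  polylog_le (2160 * 16 : R) 1 n (SMP rho (@GAPIP n)) (coll rho n).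
Proof.
move=> n2; have n0 : (0 < n)%N by apply: ltnW.
have C0 : 0 < 2160 * 16 :> R by lra.
case: (coll_cases n) => [->|[P [cP ->]]]; first exact: polylog_top.
(* [t.+1] bits for the index, 6 for the 54 repetitions and [8 * t] for the vector. *)
set t := trunc_log 2 n; pose L := (9 * t + 7)%N.
have JM : (#|{: 'I_n * 'I_54}| * #|{: 'rV['F_2]_(8 * t)}| < 2 ^ L)%N.
  rewrite card_prod !card_ord card_mx card_Fp // mul1n.
  rewrite (_ : L = (t.+1 + 6) + 8 * t)%N; last by rewrite /L; lia.
  rewrite [in X in (_ < X)%N]expnD ltn_pmul2r ?expn_gt0 // expnD.
  by apply: ltn_mul => //; rewrite trunc_log_ltn.
have fE x y z : GAPIP x y = Some z ->
    (2 * n <= 3 * #|[set i : 'I_n | (dot2 (x i) (y i) == 1)%R == z]|)%N.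
  rewrite /GAPIP /gapip; case: ifP => [h [<-]|_].
    apply: leq_trans h _; rewrite leq_mul2l /=; apply: subset_leq_card.
    by apply/fintype.subsetP => i; rewrite !inE => /eqP ->.
  case: ifP => // h [<-]; apply: leq_trans h _; rewrite leq_mul2l /=.
  by apply: subset_leq_card; apply/fintype.subsetP => i; rewrite !inE eqb_id.
have [Q [eQ cQ]] := smp_of_collision n0 cP false
  (a := fun i (x : {ffun 'I_n -> 'rV['F_2]_(8 * t)}) => x i)
  (b := fun i (y : {ffun 'I_n -> 'rV['F_2]_(8 * t)}) => y i)
  (g := fun i u v => dot2 u v == 1) fE JM.
have d3 : (9 / 40 : R) < 3^-1 by lra.
rewrite /polylog_le; apply: le_trans (SMP_le d3 eQ) _.
rewrite -EFinM lee_fin expr1.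
apply: (@le_trans _ _ ((2160 * col_complexity rho P * L)%:R)); first by rewrite ler_nat.
have lt : t%:R <= log2 (n%:R : R) := trunc_log_le_log2 R n0.
have s0 : 0 <= (col_complexity rho P)%:R :> R by [].
have t0 : 0 <= t%:R :> R by [].
have LE : L%:R <= 16 * (1 + log2 n%:R) :> R by rewrite /L natrD natrM; lra.
exact: cost_budget s0 LE.
Qed.

Lemma GAPIP_lower n : (2 <= n)%N -> (exists t, n = (2 ^ t)%N) ->
  polylog_le (96 * 1156 : R) 0 n (coll rho n) (SMP rho (@GAPIP n)).
Proof.
move=> n2 npow; have n0 : (0 < n)%N by apply: ltnW.
have C0 : 0 < 96 * 1156 :> R by lra.
case: (SMP_cases (@GAPIP n)) => [->|[P [[delta d3 eP] ->]]]; first exact: polylog_top.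
rewrite /polylog_le expr0 mulr1 -EFinM.
have c0 := GAPIP_cost_gt0 n2 d3 eP.
have c1 : 1 <= (smp_cost rho P)%:R :> R by rewrite ler1n.
have [n8|lt8] := leqP 8 n.
  have [Q [cQ le_cost]] := collision_of_gapip n2 d3 eP n8 npow.
  apply: le_trans (coll_le cQ) _; rewrite lee_fin.
  apply: (@le_trans _ _ ((96 * (1156 * smp_cost rho P))%:R)); first by rewrite ler_nat.
  by rewrite !natrM mulrA.
(* For [n] below 8 outputting the whole domain costs a constant, and the protocol costs at least
   1. *)
apply: le_trans (coll_trivial n) _; rewrite lee_fin.
have : (n%:R : R) <= 8 by rewrite ler_nat ltnW.
lra.
Qed.

End Costs.

Section Simulation.
Variables (R : realType) (U V U' V' : finType).
Variables (rho : dist R (U * V)%type) (rho' : dist R (U' * V')%type) (n : nat).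
Hypothesis n0 : (0 < n)%N.
Variables (Z : eqType) (f : n.-tuple bool -> n.-tuple bool -> option Z).

Lemma SMP_simulation :
  polylog_le (2160 * 224 : R) 1 n (SMP rho f) (SMP rho' f * coll rho n)%E.
Proof.
have C0 : 0 < 2160 * 224 :> R by lra.
case: (SMP_cases rho' f) => [->|[P' [[delta d3 eP'] ->]]].
  by rewrite gt0_mulye ?coll_gt0 //; exact: polylog_top.
have [c0|c0] := posnP (smp_cost rho' P').
  have [Q [eQ cQ]] := silent_transfer rho eP' c0.
  by have := SMP_le d3 eQ; rewrite /polylog_le cQ c0 mul0e mule0.
case: (coll_cases rho n) => [->|[P [cP ->]]].
  by rewrite gt0_muley ?lte_fin ?ltr0n //; exact: polylog_top.
(* A default vote is needed, and the referee's nonempty seed space provides an element of [Z]. *)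
have z0 : Z := referee (s := P') [::] [::] (sval (cid (dist_inhabited (coinR P')))).
set c := smp_cost rho' P' in c0 *.
have cardXY : (#|{: n.-tuple bool}| * #|{: n.-tuple bool}| <= 4 ^ n)%N.
  by rewrite card_tuple card_bool -expnMn.
have err x y z : f x y = Some z ->
    Ex (smp_dist rho' P') (fun w => (answer x y w != z)%:R) <= 3^-1.
  move=> /eP'; rewrite PrE => h.
  have -> : Ex (smp_dist rho' P') (fun w => (answer x y w != z)%:R) =
      1 - Ex (smp_dist rho' P') (fun w => (answer x y w == z)%:R).
    rewrite -[X in X - _](Ex_cst (smp_dist rho' P')) -ExB; apply: eq_Ex => w.
    by case: (_ == _); rewrite ?subrr ?subr0.
  by move: h d3; lra.
have [w [w0 wgood]] := newman n0 cardXY err z0.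
(* The local message at index [i] consists of the player's messages on all 108 fixed samples of
   block [i]; the block is public, so the referee can replay the runs. *)
pose M := {ffun 'I_108 -> c.-bseq bool}.
pose a (i : 'I_n) (x : n.-tuple bool) : M := [ffun k => insub_bseq c (msgA x (w i k))].
pose b (i : 'I_n) (y : n.-tuple bool) : M := [ffun k => insub_bseq c (msgB y (w i k))].
pose g (i : 'I_n) (m m' : M) : Z := majority z0
  [seq referee (s := P') (m k) (m' k) (w i k).2.2 | k <- enum 'I_108].
have gE i x y : g i (a i x) (b i y) =
    majority z0 [seq answer x y (w i k) | k <- enum 'I_108].
  rewrite /g; congr majority; apply: eq_map => k; rewrite !ffunE /answer.
  have sz := msg_size_le x y (w0 i k).
  by rewrite !val_insub_bseq //; [apply: leq_trans sz; exact: leq_addl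
                                 |apply: leq_trans sz; exact: leq_addr].
have fE x y z : f x y = Some z ->
    (2 * n <= 3 * #|[set i : 'I_n | g i (a i x) (b i y) == z]|)%N.
  move=> /wgood h; apply: leq_trans h _; rewrite leq_mul2l /=; apply: subset_leq_card.
  by apply/fintype.subsetP => i; rewrite !inE gE.
(* [t + 7] bits for the slot and [c.+1] for each of the 108 messages, strings of length at most [c]
   numbering less than 2^(c+1). *)
set t := trunc_log 2 n; pose L := (t + 7 + 108 * c.+1)%N.
have JM : (#|{: 'I_n * 'I_54}| * #|{: M}| < 2 ^ L)%N.
  apply: (@leq_ltn_trans (n * 54 * 2 ^ (108 * c.+1))).
    rewrite card_prod card_ffun !card_ord leq_mul2l; apply/orP; right.
    by rewrite [(108 * _)%N]mulnC expnM leq_exp2r // card_bseq_bool.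
  rewrite expnD ltn_pmul2r ?expn_gt0 // (_ : t + 7 = t.+1 + 6)%N; last by lia.
  by rewrite expnD; apply: ltn_mul => //; rewrite trunc_log_ltn.
have [Q [eQ cQ]] := smp_of_collision n0 cP z0 fE JM.
have d40 : (9 / 40 : R) < 3^-1 by lra.
rewrite /polylog_le; apply: le_trans (SMP_le d40 eQ) _.
rewrite -!EFinM lee_fin expr1.
apply: (@le_trans _ _ ((2160 * col_complexity rho P * L)%:R)); first by rewrite ler_nat.
have lt : t%:R <= log2 (n%:R : R) := trunc_log_le_log2 R n0.
have s0 : 0 <= (col_complexity rho P)%:R :> R by [].
have t0 : 0 <= t%:R :> R by [].
have c1 : 1 <= c%:R :> R by rewrite ler1n.
have LE : L%:R <= 224 * (1 + log2 n%:R) * c%:R :> R.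
  rewrite /L !natrD natrM -[c.+1%:R]natr1; nra.
rewrite mulrA [leRHS]mulrAC -mulrA.
rewrite mulrA; apply: le_trans (cost_budget s0 LE) _.
by rewrite le_eqVlt; apply/orP; left; apply/eqP; ring.
Qed.

End Simulation.

Theorem theorem1p8 (R : realType) :
  (exists (C : R) (k : nat),
     forall (U V : finType) (rho : dist R (U * V)%type), ~ degenerate rho ->
     forall n : nat, (0 < n)%N ->
     forall (Z : eqType) (f : n.-tuple bool -> n.-tuple bool -> option Z),
       polylog_le C k n (SMP rho f) (SMP (perf R) f * coll rho n)%E) /\
  ((exists (C : R) (k : nat),
     forall (U V : finType) (rho : dist R (U * V)%type), ~ degenerate rho ->
     forall n : nat, (2 <= n)%N -> (exists t : nat, n = (2 ^ t)%N) ->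
       polylog_le C k n (SMP rho (@GAPIP n)) (coll rho n)) /\
   (exists (C : R) (k : nat),
     forall (U V : finType) (rho : dist R (U * V)%type), ~ degenerate rho ->
     forall n : nat, (2 <= n)%N -> (exists t : nat, n = (2 ^ t)%N) ->
       polylog_le C k n (coll rho n) (SMP rho (@GAPIP n)))).
Proof.
split.
  exists (2160 * 224), 1%N => U V rho _ n n0 Z f; exact: SMP_simulation.
split.
  exists (2160 * 16), 1%N => U V rho _ n n2 _; exact: GAPIP_upper.
exists (96 * 1156), 0%N => U V rho _ n n2 npow; exact: GAPIP_lower.
Qed.
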